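(* For any integer $q\ge2$, $\mathrm{QACC}=\mathrm{QACC}[q]$; that is, every operator family in $\mathrm{QACC}$ is $\mathrm{QAC}^0$-reducible to (i.e. can be simulated up to work bits by) a family in $\mathrm{QACC}[q]$, and conversely.
   Context: Gates: one-qubit gates are elements of $U(2)$; for $U\in U(2)$, $\wedge_m(U)$ applies $U$ to the last qubit iff the first $m$ qubits are all $1$; a Toffoli gate is $\wedge_m(X)$, $X=\begin{pmatrix}0&1\\1&0\end{pmatrix}$, $m\ge0$; a controlled-not is $\wedge_1(X)$; a controlled-not layer performs, in one step, controlled-nots between an arbitrary collection of disjoint pairs of lines. For Boolean $y$, $\mathrm{Mod}_q(y_1,\ldots,y_m)=1$ iff $\sum y_i\not\equiv0\pmod q$, and the quantum $\mathrm{MOD}_q$ gate maps $|y_1,\ldots,y_m,x\rangle\mapsto|y_1,\ldots,y_m,x\oplus\mathrm{Mod}_q(y)\rangle$. $\mathrm{QAC}^0$ is the class of families $\{F_n\}$, $F_n\in U(2^{n+p(n)})$ ($p$ a polynomial), each $F_n$ a product of $O(1)$ layers, each layer either a Kronecker product of one-qubit and Toffoli gates or a controlled-not layer, with the number of distinct one-qubit gate types fixed independently of $n$. $\mathrm{QACC}[q]$ is defined the same way but layers may also contain (unbounded fan-in) $\mathrm{MOD}_q$ gates, and $\mathrm{QACC}=\bigcup_q\mathrm{QACC}[q]$. $\{F_n\}$ is $\mathrm{QAC}^0$-reducible to $\{G_n\}$ if there is a family $\{R_n\}$ of $\mathrm{QAC}^0$ operators augmented with operators from $\{G_n\}$ such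 that for all $n$, ${\bf x},{\bf y}\in\{0,1\}^n$ some work-bit setting ${\bf z}\in\{0,1\}^{p(n)}$ gives $\langle{\bf y}|F_n|{\bf x}\rangle=\langle{\bf y},{\bf z}|R_n|{\bf x},{\bf z}\rangle$. Equality of operator classes is understood up to this mutual reducibility. *)

(* Defs.v *)
From HB Require Import structures.
From mathcomp Require Import all_boot all_order all_algebra.
From mathcomp.real_closed Require Import complex.
From mathcomp Require Import reals.

Import Order.TTheory GRing.Theory Num.Theory.
Local Open Scope ring_scope.

(* Basis states of N qubits: bit strings of length N. *)
Definition bits (N : nat) := (N.-tuple bool)%type.

(* An operator on N qubits, given by its matrix entries  A y x = <y|A|x>. *)
Definition op (C : Type) (N : nat) := bits N -> bits N -> C.

Definition opmul (C : numClosedFieldType) N (A B : op C N) : op C N :=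
  fun y x => \sum_(z : bits N) A y z * B z x.
Definition opid (C : numClosedFieldType) N : op C N :=
  fun y x => if y == x then 1 else 0.

Record qfamily (C : Type) := Family {
  fam_p : nat -> nat;
  fam_op : forall n, op C (n + fam_p n) }.

Definition poly_bounded (p : nat -> nat) : Prop :=
  exists c k : nat, forall n, (p n <= c * n ^ k + c)%N.

Definition unitary2 (C : numClosedFieldType) (U : 'M[C]_2) : bool :=
  U *m (map_mx Num.conj U)^T == 1%:M.

(* Gates.  G1 U : one-qubit gate U (arity 1);
   Tof m : the Toffoli gate /\_m(X) (arity m+1, target last);
   Mod q m : the MOD_q gate with m inputs y_1..y_m and target x (arity m+1);
   Orc k : the oracle gate G_k of a qfamily {G_n} (arity k + p_G k). *)
Inductive gate (C : numClosedFieldType) :=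
| G1 of 'M[C]_2
| Tof of nat
| Mod of nat & nat
| Orc of nat.

Definition gate_arity (C : numClosedFieldType) (O : qfamily C) (g : gate C) : nat :=
  match g with
  | G1 _ => 1
  | Tof m => m.+1
  | Mod _ m => m.+1
  | Orc k => (k + fam_p C O k)%N
  end.

Definition bidx (b : bool) : 'I_2 := inord (nat_of_bool b).
Definition to_bits N (s : seq bool) : bits N := [tuple nth false s i | i < N].

Definition tof_map (m : nat) (x : seq bool) : seq bool :=
  take m x ++ [:: nth false x m (+) all id (take m x)].
Definition mod_map (q m : nat) (x : seq bool) : seq bool :=
  take m x ++ [:: nth false x m (+) (count id (take m x) %% q != 0)%N].

(* <y|g|x> for bit strings y, x of length (gate_arity g) *)
Definition gate_sem (C : numClosedFieldType) (O : qfamily C) (g : gate C) (y x : seq bool) : C :=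
  match g with
  | G1 U => U (bidx (head false y)) (bidx (head false x))
  | Tof m => if y == tof_map m x then 1 else 0
  | Mod q m => if y == mod_map q m x then 1 else 0
  | Orc k => fam_op C O k (to_bits _ y) (to_bits _ x)
  end.

(* Layers: a Kronecker product G_1 (x) ... (x) G_k of gates (acting on
   consecutive blocks of lines, in order), or a controlled-not layer given by
   a list of (control, target) pairs of lines. *)
Inductive layer (C : numClosedFieldType) :=
| Kron of seq (gate C)
| CNOTs of seq (nat * nat).

Fixpoint kron_sem (C : numClosedFieldType) (O : qfamily C) (gs : seq (gate C)) (y x : seq bool) : C :=
  match gs with
  | [::] => 1
  | g :: gs' =>
      let a := gate_arity C O g in
      gate_sem C O g (take a y) (take a x) * kron_sem C O gs' (drop a y) (drop a x)
  end.

Definition cnot_map N (ps : seq (nat * nat)) (x : bits N) : bits N :=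
  [tuple match [seq pr.1 | pr <- ps & pr.2 == (i : nat)] with
         | c :: _ => tnth x i (+) nth false x c
         | [::] => tnth x i
         end | i < N].

Definition layer_sem (C : numClosedFieldType) (O : qfamily C) N (L : layer C) : op C N :=
  match L with
  | Kron gs => fun y x => kron_sem C O gs y x
  | CNOTs ps => fun y x => if y == cnot_map N ps x then 1 else 0
  end.

Definition wf_layer (C : numClosedFieldType) (O : qfamily C) (ok : gate C -> bool) N (L : layer C) : bool :=
  match L with
  | Kron gs => all ok gs && (sumn (map (gate_arity C O) gs) == N)
  | CNOTs ps =>
      all (fun pr => [&& (pr.1 < N)%N, (pr.2 < N)%N & pr.1 != pr.2] ) ps
      && uniq (flatten [seq [:: pr.1; pr.2] | pr <- ps])
  end.

Fixpoint circ_sem (C : numClosedFieldType) (O : qfamily C) N (Ls : seq (layer C)) : op C N :=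
  match Ls with
  | [::] => opid C N
  | L :: Ls' => opmul C N (circ_sem C O N Ls') (layer_sem C O N L)
  end.

(* Allowed gates; S is the fixed finite set of one-qubit gate types. *)
Definition qac0_gate (C : numClosedFieldType) (S : seq 'M[C]_2) (g : gate C) : bool :=
  match g with G1 U => U \in S | Tof _ => true | _ => false end.
Definition qacc_gate (C : numClosedFieldType) (q : nat) (S : seq 'M[C]_2) (g : gate C) : bool :=
  match g with G1 U => U \in S | Tof _ => true | Mod q' _ => q' == q | Orc _ => false end.
Definition aug_gate (C : numClosedFieldType) (S : seq 'M[C]_2) (g : gate C) : bool :=
  match g with G1 U => U \in S | Tof _ => true | Mod _ _ => false | Orc _ => true end.

Definition dummy_family (C : numClosedFieldType) : qfamily C :=
  Family C (fun _ => 0%N) (fun n (y x : bits (n + 0)) => 0).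

Definition in_class (C : numClosedFieldType) (ok : seq 'M[C]_2 -> gate C -> bool) (F : qfamily C) : Prop :=
  poly_bounded (fam_p C F) /\
  exists (d : nat) (S : seq 'M[C]_2) (Cn : forall n, seq (layer C)),
    all (unitary2 C) S /\
    forall n, (size (Cn n) <= d)%N /\
      all (wf_layer C (dummy_family C) (ok S) (n + fam_p C F n)) (Cn n) /\
      forall y x, fam_op C F n y x = circ_sem C (dummy_family C) _ (Cn n) y x.

Definition QAC0 (C : numClosedFieldType) := in_class C (qac0_gate C).
Definition QACCq (C : numClosedFieldType) (q : nat) := in_class C (qacc_gate C q).
Definition QACC (C : numClosedFieldType) (F : qfamily C) := exists q, (2 <= q)%N /\ QACCq C q F.

(* {F_n} is QAC^0-reducible to {G_n}: QAC^0 circuits R_n augmented with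
   gates from {G_n}, on the lines of F_n plus pw n work bits. *)
Definition qac0_reducible (C : numClosedFieldType) (F G : qfamily C) : Prop :=
  exists (pw : nat -> nat) (d : nat) (S : seq 'M[C]_2) (Rn : forall n, seq (layer C)),
    poly_bounded (fun n => fam_p C F n + pw n)%N /\
    all (unitary2 C) S /\
    forall n, (size (Rn n) <= d)%N /\
      all (wf_layer C G (aug_gate C S) (n + fam_p C F n + pw n)) (Rn n) /\
      forall y x : bits (n + fam_p C F n), exists z : bits (pw n),
        fam_op C F n y x = circ_sem C G _ (Rn n) (cat_tuple y z) (cat_tuple x z).

(* Main.v *)
Require Import Defs.
From Stdlib Require Import FunctionalExtensionality.
From mathcomp Require Import all_boot all_order all_algebra.
From mathcomp Require Import cyclic cyclotomic separable zify.
From mathcomp.real_closed Require Import complex.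
From mathcomp Require Import reals.

(* The simulation goes through the fan-out gate.

   For one target, prepare a register u of q qubits in a product state such
   that f(u), the number of leading ones of u, is uniform on Z/q, multiply the
   amplitude of u by zeta^f(u) for a q-th root of unity zeta, and undo the
   preparation.  The amplitude at u = 0 is then the mean of the powers of zeta:
   u is certainly 0 if zeta = 1 and certainly not 0 otherwise.  Hence a Toffoli
   gate on u writes the bit [zeta <> 1] to the target, and u can be cleaned.

   - Fan-out from MOD_q: every target of a control c owns a register, and
     zeta = w^c for a primitive root w.  The total phase w^(c * sum of the f(u))
     depends on the sum modulo q only, and MOD_q gates compute the indicators
     of its residues.
   - MOD_q' from fan-out: zeta = w^(y_1 + ... + y_n) is a product of
     contributions of the separate inputs, so it suffices to fan out f(u), in
     unary, to all of them.

   The gadgets act on all the targets of a layer at once: a line that is not a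
   target gets zeta = 1 and is left alone.  Finally a layer of disjoint gates on
   arbitrary lines becomes a Kronecker product once CNOT layers have moved the
   lines to fresh positions in the order of the gates. *)

Set Implicit Arguments.
Unset Strict Implicit.
Unset Printing Implicit Defensive.

Import Order.TTheory GRing.Theory Num.Theory.
Local Open Scope ring_scope.

(** Write q = m + 1. The simulation is exact and superpositions come from one-qubit gates, so the
    register has to start in a product state. Counting leading ones makes this possible: if qubit k
    is one with probability (m - k)/(m + 1 - k), the probabilities telescope to P(f(u) > k) = (m -
    k)/(m + 1), and f(u) is uniform on 0, ..., m. These rotations depend on q alone, so the set of
    one-qubit gates stays fixed.

    A MOD_q gate returns a bit and not a phase. With w^j attached to the j-th of the q bits
    [n + j <> 0 mod q], the product is w^n times a constant, which is cancelled on the control line.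

    Fan-out is the intermediate gate because gates of one layer must not share lines, while every
    input of a MOD gate needs its own copy of f(u).

    A Toffoli gate tests for ones, not zeros. Hence the register is negated before the test, the
    test yields [zeta = 1], and a NOT on the target turns this into [zeta <> 1].

    The register can be cleaned because zeta does not depend on the targets: the second half of the
    gadget, run after the targets have changed, is still the exact inverse of the first. *)

Section Kernels.
Variable C : numClosedFieldType.
Implicit Types X Y Z : finType.

(** * Matrices as kernels, and simulation along encodings of basis states *)

Definition kmul X (A B : X -> X -> C) : X -> X -> C :=
  fun y x => \sum_z A y z * B z x.
Definition kmap X (f : X -> X) : X -> X -> C := fun y x => (y == f x)%:R.

(* [B] maps the encoding [i x] to the encoding [j] of [A x]. *)
Definition sim X Y (i j : X -> Y) (A : X -> X -> C) (B : Y -> Y -> C) :=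
  forall x y, B y (i x) = \sum_x' (y == j x')%:R * A x' x.

Lemma sum_delta X (x : X) (F : X -> C) : \sum_z (z == x)%:R * F z = F x.
Proof.
rewrite (bigD1 x) //= eqxx mul1r big1 ?addr0 // => z /negbTE ->.
by rewrite mul0r.
Qed.

Lemma sum_deltar X (x : X) (F : X -> C) : \sum_z F z * (z == x)%:R = F x.
Proof. by rewrite -[RHS](sum_delta x); apply: eq_bigr => z _; rewrite mulrC. Qed.

Lemma kmul_mapr X (A : X -> X -> C) f y x : kmul A (kmap f) y x = A y (f x).
Proof. exact: sum_deltar. Qed.

Lemma kmulA X (A B D : X -> X -> C) : kmul A (kmul B D) = kmul (kmul A B) D.
Proof.
apply: functional_extensionality => y; apply: functional_extensionality => x.
rewrite /kmul; under eq_bigr do rewrite big_distrr /=.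
rewrite exchange_big; apply: eq_bigr => z _; rewrite big_distrl /=.
by apply: eq_bigr => t _; rewrite mulrA.
Qed.

Lemma kmul1 X (A : X -> X -> C) : kmul A (kmap id) = A.
Proof.
apply: functional_extensionality => y; apply: functional_extensionality => x.
by rewrite kmul_mapr.
Qed.

Lemma kmul1l X (A : X -> X -> C) : kmul (kmap id) A = A.
Proof.
apply: functional_extensionality => y; apply: functional_extensionality => x.
by rewrite /kmul /kmap; under eq_bigr do rewrite eq_sym; rewrite sum_delta.
Qed.

Lemma kmap_comp X (f g : X -> X) : kmul (kmap f) (kmap g) = kmap (f \o g).
Proof.
apply: functional_extensionality => y; apply: functional_extensionality => x.
by rewrite kmul_mapr.
Qed.

Lemma sim_mul X Y (i j k : X -> Y) A A' B B' :
  sim j k A' B' -> sim i j A B -> sim i k (kmul A' A) (kmul B' B).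
Proof.
move=> h' h x y; rewrite /kmul.
under eq_bigr => z _ do rewrite h big_distrr /=.
rewrite exchange_big /=.
under eq_bigr => x' _.
  under eq_bigr => z _ do rewrite mulrCA.
  rewrite sum_delta h' big_distrl /=; over.
rewrite exchange_big /=; apply: eq_bigr => x' _; rewrite big_distrr /=.
by apply: eq_bigr => z _; rewrite mulrA.
Qed.

Lemma sim_comp X Y Z (i j : X -> Y) (k l : Y -> Z) A B D :
  sim i j A B -> sim k l B D -> sim (k \o i) (l \o j) A D.
Proof.
move=> h h' x z; rewrite /= h'.
under [LHS]eq_bigr => y _ do rewrite h big_distrr /=.
rewrite exchange_big /=; apply: eq_bigr => x' _.
under eq_bigr => y _ do rewrite mulrCA.
by rewrite sum_delta.
Qed.

Lemma sim_map X Y (i j : X -> Y) f g :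
  (forall x, g (i x) = j (f x)) -> sim i j (kmap f) (kmap g).
Proof. by move=> h x y; rewrite /kmap sum_deltar h. Qed.

Lemma sim_inj X Y (i : X -> Y) A B :
  injective i -> sim i i A B -> forall y x, B (i y) (i x) = A y x.
Proof.
move=> inj h y x; rewrite h; under eq_bigr => z _ do rewrite (inj_eq inj) eq_sym.
by rewrite sum_delta.
Qed.

End Kernels.

(** * Circuits on an arbitrary finite set of lines *)

Section Circuits.
Variable C : numClosedFieldType.

Definition state (T : finType) := {ffun T -> bool}.

(* Kind [0] is the Toffoli gate, kind [q > 0] the gate MOD_q; a gate is its
   kind, its list of controls and its target. *)
Definition mgate (T : finType) := (nat * seq T * T)%type.
Definition fires (k : nat) (bs : seq bool) : bool :=
  if k is 0 then all id bs else (count id bs %% k != 0)%N.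

Inductive mlayer (T : finType) := One of (T -> 'M[C]_2) | Cl of seq (mgate T).

Variable T : finType.
Implicit Types (g : mgate T) (gs : seq (mgate T)) (s : state T).

Definition lines g := rcons g.1.2 g.2.
Definition gbit s g := fires g.1.1 (map s g.1.2).
(** All gates read the old state and the bits of a common target are added, so the map makes sense
    without any disjointness condition. *)
Definition cmap gs s : state T :=
  [ffun t => s t (+) \big[addb/false]_(g <- gs | g.2 == t) gbit s g].

Definition one_sem (U : T -> 'M[C]_2) : state T -> state T -> C :=
  fun y x => \prod_t U t (bidx (y t)) (bidx (x t)).
Definition lsem (L : mlayer T) : state T -> state T -> C :=
  match L with One U => one_sem U | Cl gs => kmap C (cmap gs) end.
Fixpoint csem (Ls : seq (mlayer T)) : state T -> state T -> C :=
  if Ls is L :: Ls' then kmul (csem Ls') (lsem L) else kmap C id.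

Lemma csem_cat Ls Ls' : csem (Ls ++ Ls') = kmul (csem Ls') (csem Ls).
Proof.
elim: Ls => [|L Ls IH] /=; first by rewrite kmul1.
by rewrite IH kmulA.
Qed.

Definition strict (K : seq nat) gs :=
  all (fun g => g.1.1 \in K) gs && uniq (flatten (map lines gs)).
Definition one_way gs := all (fun g => all (fun g' => g.2 \notin g'.1.2) gs) gs.
(** Several gates may share their control, which [strict] forbids. *)
Definition fanout gs :=
  [&& all (fun g => (g.1.1 == 0)%N && (size g.1.2 == 1)%N) gs,
      uniq (map snd gs) & one_way gs].

Definition lok (S : seq 'M[C]_2) (P : pred (seq (mgate T))) (L : mlayer T) :=
  match L with One U => [forall t, U t \in S] | Cl gs => P gs end.

Lemma cmap_notin gs s t : t \notin map snd gs -> cmap gs s t = s t.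
Proof.
move=> h; rewrite ffunE big_seq_cond big1 ?addbF // => g /andP[gin /eqP e].
by rewrite -e map_f in h.
Qed.

Lemma cmap_in gs s g : uniq (map snd gs) -> g \in gs ->
  cmap gs s g.2 = s g.2 (+) gbit s g.
Proof.
move=> uq gin; rewrite ffunE; congr (_ (+) _).
elim: gs uq gin => //= h gs IH /andP[nin uq]; rewrite inE big_cons.
case/orP=> [/eqP eg|gin].
  rewrite -eg in nin *; rewrite eqxx big_seq_cond big1 ?addbF // => g' /andP[gin' /eqP e].
  by move/mapP: nin; case; exists g'.
case: eqP => [e|_]; last exact: IH.
by move/mapP: nin; case; exists g.
Qed.

Lemma cmap_same gs s s' : one_way gs ->
  (forall t, t \notin map snd gs -> s' t = s t) ->
  forall g, g \in gs -> gbit s' g = gbit s g.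
Proof.
move=> /allP ow h g gin; congr fires; apply/eq_in_map => t tin; apply: h.
apply/mapP => -[g' gin' e]; have /allP/(_ _ gin) := ow _ gin'.
by rewrite -e tin.
Qed.

(** The second application finds unchanged controls and adds the same bits again. Computed work bits
    can therefore be erased by the reversed list of layers. *)
Lemma cmapK gs : one_way gs -> involutive (cmap gs).
Proof.
move=> ow s; apply/ffunP => t; rewrite ffunE [in X in X (+) _]ffunE -addbA.
rewrite [X in _ (+) (_ (+) X)](_ : _ = \big[addb/false]_(g <- gs | g.2 == t) gbit s g).
  by rewrite addbb addbF.
rewrite big_seq_cond [RHS]big_seq_cond; apply: eq_bigr => g /andP[gin _].
by apply: cmap_same gin => // t' /cmap_notin.
Qed.

Lemma strict_one_way K gs : strict K gs -> one_way gs && uniq (map snd gs).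
Proof.
case/andP=> _; elim: gs => //= g gs IH; rewrite cat_uniq => /and3P[u1 nh /IH].
have sub g' t : g' \in gs -> t \in lines g' -> t \in flatten (map lines gs).
  by move=> gin tin; apply/flatten_mapP; exists g'.
have nin t : t \in lines g -> t \in flatten (map lines gs) -> False.
  by move=> tg tf; move/hasPn: nh => /(_ _ tf); rewrite /= tg.
have last g' : g'.2 \in lines g' by rewrite mem_rcons inE eqxx.
have ctl g' t : t \in g'.1.2 -> t \in lines g' by rewrite mem_rcons inE orbC => ->.
case/andP=> ow uq; rewrite uq andbT; apply/andP; split; last first.
  by apply/mapP => -[g' gin e]; apply: (nin g.2) => //; apply: sub gin _; rewrite e.
rewrite /one_way /=; apply/andP; split.
  apply/andP; split; first by move: u1; rewrite rcons_uniq => /andP[].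
  apply/allP => g' gin; apply/negP => tin.
  by apply: (nin g.2) => //; apply: sub gin _; apply: ctl.
apply/allP => g' gin; rewrite /=; apply/andP; split; last exact: (allP ow).
by apply/negP => tin; apply: (nin g'.2); [apply: ctl|apply: sub gin _].
Qed.

Lemma mulmx_bidx (A B : 'M[C]_2) i j :
  (A *m B) i j = \sum_b A i (bidx b) * B (bidx b) j.
Proof.
rewrite mxE (reindex_onto bidx (fun i : 'I_2 => i == 1 :> nat)%N) /=; last first.
  by move=> k _; apply/val_inj; case: k => [[|[|k]] hk] //=; rewrite inordK.
by apply: eq_bigl => b; apply/eqP; case: b; rewrite /= inordK.
Qed.

Lemma one_semM U U' : kmul (one_sem U) (one_sem U') = one_sem (fun t => U t *m U' t).
Proof.
apply: functional_extensionality => y; apply: functional_extensionality => x.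
rewrite /kmul /one_sem; under [RHS]eq_bigr => t _ do rewrite mulmx_bidx.
by rewrite bigA_distr_bigA; apply: eq_bigr => z _; rewrite -big_split.
Qed.

Lemma bidx_eq b b' : (bidx b == bidx b') = (b == b').
Proof. by case: b b' => [] []; rewrite -val_eqE /= !inordK. Qed.

Lemma one_sem1 : one_sem (fun _ => 1%:M) = kmap C id.
Proof.
apply: functional_extensionality => y; apply: functional_extensionality => x.
rewrite /one_sem /kmap; case: eqP => [->|ne].
  by rewrite big1 // => t _; rewrite mxE eqxx.
have [t nt] : exists t, y t != x t.
  apply/existsP; apply: contra_notT ne => /existsPn h.
  by apply/ffunP => t; apply/eqP; rewrite -[_ == _]negbK.
by rewrite (bigD1 t) //= mxE bidx_eq (negbTE nt) mul0r.
Qed.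

End Circuits.

(** * Work lines attached to every line *)

Section Extension.
Variables (C : numClosedFieldType) (T : finType) (m : nat).

Definition slot := (bool * bool * bool)%type.
(* Every line [t] is accompanied by [m.+1] work lines for each slot; the
   original line is [(t, None)]. *)
Definition ext : finType := (T * option (slot * 'I_m.+1))%type.

Definition emb (s : state T) : state ext :=
  [ffun l : ext => if l.2 is None then s l.1 else false].

Definition lift_layer (L : mlayer C T) : mlayer C ext :=
  match L with
  | One U => One (fun l : ext => if l.2 is None then U l.1 else 1%:M)
  | Cl gs => Cl C [seq (g.1.1, [seq (t, None) | t <- g.1.2], (g.2, None)) | g <- gs]
  end.

Lemma emb_inj : injective emb.
Proof.
move=> s s' /ffunP e; apply/ffunP => t.
by move: (e (t, None)); rewrite !ffunE.
Qed.

Lemma prod_ext (F : ext -> C) : \prod_l F l = \prod_t \prod_w F (t, w).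
Proof. by rewrite pair_bigA; apply: eq_bigr => -[]. Qed.

Lemma sim_lift L : sim emb emb (lsem L) (lsem (lift_layer L)).
Proof.
case: L => [U|gs] /=; last first.
  apply: sim_map => s; apply/ffunP => -[t [w|]]; rewrite !ffunE /=.
    rewrite big_map big_pred0 // => g; rewrite /= xpair_eqE andbC.
    by case: eqP.
  congr (_ (+) _); rewrite big_map; apply: eq_big => [g|g _].
    by rewrite /= xpair_eqE eqxx andbT.
  rewrite /gbit /= -map_comp; congr fires; apply: eq_map => t'.
  by rewrite /= ffunE.
move=> x y; pose r : state T := [ffun t => y (t, None)].
(* An output with clear work lines is the embedding of its restriction [r]; any other one has a set
   work line, where the identity factor vanishes. *)
have [->|ne] := eqVneq y (emb r).
  under eq_bigr => z _ do rewrite (inj_eq emb_inj) eq_sym.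
  rewrite sum_delta /one_sem prod_ext; apply: eq_bigr => t _.
  rewrite (bigD1 None) //= !ffunE /= ?ffunE big1 ?mulr1 // => -[w|] // _.
  by rewrite !ffunE mxE eqxx.
rewrite big1 => [|z _]; last first.
  case: eqP => [e|]; rewrite ?mul0r //; case/eqP: ne; rewrite e; congr emb.
  by apply/ffunP => t; rewrite !ffunE e !ffunE.
have [[t [w|]] ]: exists l, y l != emb r l.
- apply/existsP; apply: contraR ne => /existsPn h.
  by apply/eqP/ffunP => l; apply/eqP; rewrite -[_ == _]negbK.
- move=> yl; rewrite /one_sem (bigD1 (t, Some w)) //= mxE bidx_eq.
  by move: yl; rewrite !ffunE /= => /negbTE ->; rewrite mul0r.
by rewrite !ffunE eqxx.
Qed.

End Extension.

(** * A product state whose number of leading ones is uniform *)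

Section PhaseRegister.
Variables (C : numClosedFieldType) (m : nat).

Definition leading (u : 'I_m.+1 -> bool) : nat :=
  (\sum_(k < m.+1) [forall (i : 'I_m.+1 | i <= k), u i])%N.

(** The conditional probability of a count above [k], given a count of at least [k]: of the values
    [k], ..., [m] all but the first qualify. *)
Definition pr (k : nat) : C := (m - k)%:R / (m.+1 - k)%:R.

(* The reflection exchanging |0> and sqrt (1 - p) |0> + sqrt p |1>. *)
Definition refl (k : nat) : 'M[C]_2 :=
  \matrix_(i, j) if i == j then (-1) ^+ i * sqrtC (1 - pr k) else sqrtC (pr k).
Definition flip : 'M[C]_2 := \matrix_(i, j) (i != j)%:R.
Definition dmx (a : C) : 'M[C]_2 := \matrix_(i, j) ((i == j)%:R * a ^+ i).

Lemma pr_ge0 k : 0 <= pr k.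
Proof. by rewrite divr_ge0 ?ler0n. Qed.

Lemma pr_le1 k : 0 <= 1 - pr k.
Proof.
rewrite subr_ge0 /pr; case: (ltnP k m.+1) => h.
  by rewrite ler_pdivrMr ?ltr0n ?subn_gt0 // mul1r ler_nat leq_sub2r.
by rewrite (eqP (ltnW h : (m - k)%N == 0)%N) mul0r.
Qed.

Lemma mx2P (A B : 'M[C]_2) :
  [/\ A 0 0 = B 0 0, A 0 1 = B 0 1, A 1 0 = B 1 0 & A 1 1 = B 1 1] -> A = B.
Proof.
case=> e00 e01 e10 e11; apply/matrixP => i j.
have d (k : 'I_2) : k = 0 \/ k = 1.
  by case: k => [[|[|//]] hk]; [left|right]; apply/val_inj.
by case: (d i) => ->; case: (d j) => ->.
Qed.

Lemma reflK k : refl k *m refl k = 1%:M.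
Proof.
apply: mx2P; rewrite !mxE !big_ord_recl !big_ord0 !mxE /= !addr0 !expr0 !expr1.
by split; rewrite ?mul1r ?mulN1r ?mulrNN -?expr2 ?sqrtCK ?subrK // 1?[RHS]mulr0n
  1?mulNr 1?mulrN 1?[sqrtC (pr k) * _]mulrC ?subrr ?addNr // addrC subrK.
Qed.

Lemma flipK : flip *m flip = 1%:M.
Proof.
by apply: mx2P; rewrite !mxE !big_ord_recl !big_ord0 !mxE /=;
  split; rewrite ?mul0r ?mulr0 ?mulr1 ?addr0 ?add0r.
Qed.

Lemma conj_refl k : (map_mx Num.conj (refl k))^T = refl k.
Proof.
have cj a : 0 <= a -> (sqrtC a)^* = sqrtC a :> C.
  by move=> h; apply: conj_Creal; rewrite ger0_real ?sqrtC_ge0.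
by apply: mx2P; rewrite !mxE /= !rmorphM /= !rmorphXn /= !cj ?pr_ge0 ?pr_le1 //
  rmorphN rmorph1.
Qed.

Lemma conj_flip : (map_mx Num.conj flip)^T = flip.
Proof. by apply: mx2P; rewrite !mxE /= ?rmorph0 ?rmorph1. Qed.

Lemma unitary2_refl k : unitary2 C (refl k).
Proof. by rewrite /unitary2 conj_refl reflK. Qed.

Lemma unitary2_reflflip k : unitary2 C (refl k *m flip).
Proof.
rewrite /unitary2 map_mxM trmx_mul conj_refl conj_flip.
by rewrite mulmxA -(mulmxA (refl k)) flipK mulmx1 reflK.
Qed.

Lemma unitary2_flip k : unitary2 C (flip *m refl k).
Proof.
rewrite /unitary2 map_mxM trmx_mul conj_refl conj_flip.
by rewrite mulmxA -(mulmxA flip) reflK mulmx1 flipK.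
Qed.

Lemma unitary2_1 : unitary2 C 1%:M.
Proof. by rewrite /unitary2 map_mx1 trmx1 mulmx1. Qed.

Lemma unitary2_dmx a : `|a| = 1 -> unitary2 C (dmx a).
Proof.
move=> a1; apply/eqP; apply: mx2P; rewrite !mxE !big_ord_recl !big_ord0 !mxE /=.
rewrite !mul1r !mul0r ?expr0 ?expr1 !rmorph0 !rmorph1 ?mulr1 ?mulr0.
by rewrite ?addr0 ?add0r -normCK a1 expr1n.
Qed.

(** Telescoping; this is the probability that more than [k] ones lead. *)
Lemma prod_pr k : (k <= m)%N -> \prod_(i < k.+1) pr i = (m - k)%:R / m.+1%:R.
Proof.
elim: k => [|k IH] hk; first by rewrite big_ord_recl big_ord0 mulr1 /pr subn0.
rewrite big_ord_recr /= IH ?(ltnW hk) // /pr subSS mulrC mulrA.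
by rewrite mulfVK // pnatr_eq0 subn_eq0 -ltnNge.
Qed.

(** Makes the power linear in the prefix indicators. Each indicator is a product over qubits, so its
    mean in a product state is a product too. *)
Lemma telescope_leading (z : C) (a : nat -> bool) n :
  (forall i j, (i <= j)%N -> a j -> a i) ->
  z ^+ (\sum_(k < n) a k)%N = 1 + \sum_(k < n) (z ^+ k.+1 - z ^+ k) * (a k)%:R.
Proof.
move=> mono; elim: n => [|n IH]; first by rewrite !big_ord0 addr0.
rewrite !big_ord_recr /=; case an: (a n); last by rewrite addn0 mulr0 addr0.
have e k : (k < n)%N -> a k by move=> h; apply: mono an; apply: ltnW.
rewrite (eq_bigr (fun=> 1%N)) => [|i _]; last by rewrite e.
rewrite sum1_card card_ord addn1 addrA mulr1.
have -> : 1 + \sum_(k < n) (z ^+ k.+1 - z ^+ k) * (a k)%:R = z ^+ n.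
  rewrite -IH (eq_bigr (fun=> 1%N)) => [|i _]; last by rewrite e.
  by rewrite sum1_card card_ord.
by rewrite addrC subrK.
Qed.

(** The vanishing mean of the powers of a nontrivial root of unity, expressed through the tail
    probabilities of the uniform distribution. *)
Lemma geometric_pr (z : C) : z ^+ m.+1 = 1 -> z != 1 ->
  1 + \sum_(k < m.+1) (z ^+ k.+1 - z ^+ k) * ((m - k)%:R / m.+1%:R) = 0.
Proof.
move=> z1 zn1; have nz : m.+1%:R != 0 :> C by rewrite pnatr_eq0.
have g0 : \sum_(k < m.+1) z ^+ k = 0.
  apply: (@mulfI _ (z - 1)); first by rewrite subr_eq0.
  by rewrite -subrX1 z1 subrr mulr0.
(* Cleared of the denominator, this is summation by parts. It holds for all [n] and [z], hence
   induction is possible. *)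
suff e n : n%:R + 1 + \sum_(k < n.+1) (z ^+ k.+1 - z ^+ k) * (n - k)%:R
    = \sum_(k < n.+1) z ^+ k.
  apply: (mulfI nz); rewrite mulr0 -[RHS]g0 -(e m) mulrDr mulr1 natr1; congr (_ + _).
  by rewrite mulr_sumr; apply: eq_bigr => k _ /=; rewrite mulrCA [_ * (_ / _)]mulrC mulfVK.
elim: n => [|n IH].
  by rewrite !big_ord_recl !big_ord0 /= subn0 mulr0 add0r !addr0.
rewrite big_ord_recr [RHS]big_ord_recr /= subnn mulr0 addr0 -IH -natr1.
rewrite -!addrA; congr (_ + (_ + _)).
under eq_bigr => k _ do
  rewrite subSn -1?ltnS ?ltn_ord // -natr1 mulrDr mulr1.
rewrite big_split /= addrCA; congr (_ + _).
rewrite -(big_mkord xpredT (fun k => z ^+ k.+1 - z ^+ k)) telescope_sumr //.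
by rewrite expr0 addrC subrK.
Qed.

Definition reg := option (slot * 'I_m.+1).
Definition ureg (k : 'I_m.+1) : reg := Some ((true, true, true), k).
Definition uidx (w : reg) : option 'I_m.+1 :=
  if w is Some ((true, true, true), k) then Some k else None.

Lemma uidxP w : omap ureg (uidx w) = if uidx w is Some _ then Some w else None.
Proof. by case: w => [[[[[] []] []] k]|]. Qed.

Lemma prod_reg (F : 'I_m.+1 -> C) :
  \prod_(w : reg) (if uidx w is Some k then F k else 1) = \prod_k F k.
Proof.
rewrite (bigID (fun w => uidx w != None)) /= [X in _ * X]big1 ?mulr1; last first.
  by move=> w; case: (uidx w).
rewrite (reindex_omap ureg uidx) => [|w]; last by rewrite uidxP; case: (uidx w).
by apply: eq_bigl => k; rewrite /= eqxx.
Qed.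

(** The weights [G w] behave like independent random bits; lines outside the register sum out to 1,
    and what remains is the mean of [z ^+ f]. *)
Lemma expect_leading (z : C) (G : reg -> bool -> C) :
  z ^+ m.+1 = 1 -> z != 1 -> (forall w, G w true + G w false = 1) ->
  (forall k, G (ureg k) true = pr k) ->
  \sum_(v : {ffun reg -> bool}) (\prod_w G w (v w)) * z ^+ leading (v \o ureg) = 0.
Proof.
move=> z1 zn1 G1 Gp.
pose a (v : {ffun reg -> bool}) (k : nat) := [forall (i : 'I_m.+1 | (i <= k)%N), v (ureg i)].
(* Single-line factors whose product over all lines is the prefix indicator [a v k]. *)
pose h (k : nat) (w : reg) (b : bool) : C :=
  if uidx w is Some i then (if (i <= k)%N then b%:R else 1) else 1.
have ah v k : (a v k)%:R = \prod_w h k w (v w).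
  have [/forall_inP e|] := boolP (a v k).
    rewrite big1 // => w _; rewrite /h; case E: (uidx w) (uidxP w) => [i|] //= [ew].
    by case: ifP => // ik; rewrite -ew e.
  case/forallPn => i; rewrite negb_imply => /andP[ik nv].
  by rewrite (bigD1 (ureg i)) //= /h /= ik (negbTE nv) mul0r.
under eq_bigr => v _.
  rewrite /leading (telescope_leading z (a := a v)) ?mulrDr ?mulr1; last first.
    move=> i j ij /forall_inP aj; apply/forall_inP => l li.
    by apply: aj; apply: leq_trans ij.
  rewrite big_distrr /=; under [X in _ + X]eq_bigr => k _ do rewrite ah mulrCA -big_split /=.
  over.
rewrite big_split /= -(bigA_distr_bigA G) /=.
rewrite [X in X + _]big1 => [|w _]; last by rewrite big_bool /= G1.
rewrite exchange_big /= -[RHS](geometric_pr z1 zn1); congr (_ + _).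
apply: eq_bigr => k _; rewrite -big_distrr /=; congr (_ * _).
rewrite -(bigA_distr_bigA (fun w b => G w b * h k w b)) /=.
rewrite (eq_bigr (fun w => if uidx w is Some i
    then (if (i < k.+1)%N then pr i else 1) else 1)) => [|w _]; last first.
  rewrite big_bool /h /=; case: (uidx w) (uidxP w) => [i|] //=; last by rewrite !mulr1 G1.
  move=> [<-]; rewrite ltnS; case: ifP; first by rewrite mulr1 mulr0 addr0 Gp.
  by rewrite !mulr1 G1.
rewrite (prod_reg (fun i => if (i < k.+1)%N then pr i else 1)) -big_mkcond /=.
by rewrite -(big_ord_widen_cond m.+1 xpredT pr) ?ltn_ord // prod_pr // -ltnS.
Qed.

End PhaseRegister.
(** Blocks are disjoint as soon as a labelling of their elements tells them apart. The disjointness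
    of the gates in most constructed layers is shown in this way. *)
Lemma uniq_flatten_label (T' I J : eqType) (F : I -> seq T') (f : I -> J)
    (lab : T' -> J) (s : seq I) : uniq s -> {in s &, injective f} ->
  (forall i, i \in s -> uniq (F i)) ->
  (forall i l, i \in s -> l \in F i -> lab l = f i) ->
  uniq (flatten [seq F i | i <- s]).
Proof.
move=> us fi uF labF; elim: s us fi uF labF => //= i s IH /andP[nin us] fi uF labF.
rewrite cat_uniq uF ?inE ?eqxx //= IH //; last 3 first.
- by move=> j k js ks; apply: fi; rewrite inE ?js ?ks orbT.
- by move=> j js; apply: uF; rewrite inE js orbT.
- by move=> j l js; apply: labF; rewrite inE js orbT.
rewrite andbT; apply/hasPn => l /flatten_mapP[j js lj]; apply/negP => /= li.
have /fi e : f i = f j.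
  by rewrite -(labF i l) ?inE ?eqxx // (labF j l) // inE js orbT.
by move: nin; rewrite e ?inE ?eqxx ?js ?orbT.
Qed.

(** * The phase gadget for an abstract family of phases *)

Section Gadget.
Variables (C : numClosedFieldType) (T : finType) (m : nat).
Notation X := (ext T m).
Implicit Types (V : seq (seq (mgate X))) (D : X -> C) (y z : state X).

Definition vmap V z := foldl (fun z gs => cmap gs z) z V.
Definition phase V D z := \prod_l (if vmap V z l then D l else 1).
Definition on_u (U : nat -> 'M[C]_2) (l : X) : 'M[C]_2 :=
  if uidx l.2 is Some k then U k else 1%:M.
Definition kdiag (phi : state X -> C) : state X -> state X -> C :=
  fun y x => (y == x)%:R * phi x.
(** The layers [V] compute bits, [D] attaches phases to them and [rev V] erases them, so that
    everything between [A] and [B] is diagonal. *)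
Definition half V D (A B : nat -> 'M[C]_2) : seq (mlayer C X) :=
  One (on_u A) :: map (@Cl C X) V ++ One (fun l => dmx (D l)) ::
    map (@Cl C X) (rev V) ++ [:: One (on_u B)].

Definition tofs : seq (mgate X) :=
  [seq (0%N, [seq (t, ureg k) | k <- enum 'I_m.+1], (t, None) : X) | t <- enum T].
Definition nots : seq (mgate X) := [seq (0%N, [::], (t, None) : X) | t <- enum T].

(** The NOT turns a register at zero into one with all ones, which a Toffoli gate detects. [reflF]
    and [Frefl] are inverse to each other. *)
Definition reflF k : 'M[C]_2 := refl C m k *m flip C.
Definition Frefl k : 'M[C]_2 := flip C *m refl C m k.

(** [tofs] adds [zeta = 1] to the targets and [nots] corrects this to [zeta <> 1]; the second half
    inverts the first. *)
Definition gadget V D : seq (mlayer C X) :=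
  half V D (refl C m) Frefl ++ [:: Cl C tofs; Cl C nots]
    ++ half V (fun l => (D l)^-1) reflF (refl C m).

Lemma csem_Cl V : csem (map (@Cl C X) V) = kmap C (vmap V).
Proof. by elim: V => //= gs V ->; rewrite kmap_comp. Qed.

Lemma vmapK V : all (@one_way X) V -> cancel (vmap V) (vmap (rev V)).
Proof.
elim: V => //= gs V IH /andP[ow oV] z.
by rewrite rev_cons -cats1 /vmap foldl_cat /= -/(vmap V _) -/(vmap (rev V) _) IH // cmapK.
Qed.

Lemma one_sem_dmx D :
  one_sem (fun l => dmx (D l)) = kdiag (fun x => \prod_l (if x l then D l else 1)).
Proof.
apply: functional_extensionality => y; apply: functional_extensionality => x.
rewrite -[RHS]/(kmap C id y x * _) -one_sem1 -big_split; apply: eq_bigr => l _ /=.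
rewrite !mxE bidx_eq; case: eqP => [->|]; rewrite ?mul0r // !mul1r.
by case: (x l); rewrite /= inordK.
Qed.

Lemma kmul_diag phi A y x : kmul (kdiag phi) A y x = phi y * A y x.
Proof.
rewrite /kmul /kdiag; under eq_bigr => z _ do rewrite eq_sym -mulrA.
by rewrite sum_delta.
Qed.

Lemma csem_half V D A B : all (@one_way X) V ->
  csem (half V D A B) =
  kmul (one_sem (on_u B)) (kmul (kdiag (phase V D)) (one_sem (on_u A))).
Proof.
move=> oV; rewrite /half /= csem_cat /= csem_cat /= !csem_Cl kmul1l one_sem_dmx.
rewrite -!kmulA; congr kmul; rewrite !kmulA; congr kmul.
apply: functional_extensionality => y; apply: functional_extensionality => x.
rewrite kmul_mapr /kmul /kdiag.
under [LHS]eq_bigr => z _ do rewrite mulrCA.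
by rewrite sum_delta /kmap vmapK.
Qed.

Lemma on_uM A B l : on_u A l *m on_u B l = on_u (fun k => A k *m B k) l.
Proof. by rewrite /on_u; case: (uidx _) => // *; rewrite mulmx1. Qed.

Lemma one_on_u1 A : (forall k, A k = 1%:M) -> one_sem (on_u A) = kmap C id.
Proof.
move=> A1; rewrite -one_sem1; congr one_sem; apply: functional_extensionality => l.
by rewrite /on_u; case: (uidx _).
Qed.

Lemma csem_halfK V D : all (@one_way X) V -> (forall l, D l != 0) ->
  kmul (csem (half V (fun l => (D l)^-1) reflF (refl C m)))
       (csem (half V D (refl C m) Frefl)) = kmap C id.
Proof.
move=> oV Dn; rewrite !csem_half // -!kmulA.
rewrite [X in kmul _ (kmul _ X)]kmulA one_semM.
rewrite (_ : (fun t => _) = on_u (fun k => reflF k *m Frefl k)); last first.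
  by apply: functional_extensionality => l; rewrite on_uM.
rewrite (one_on_u1 (A := fun k => reflF k *m Frefl k)) ?kmul1l => [|k]; last first.
  by rewrite /reflF /Frefl mulmxA -(mulmxA _ (flip C) (flip C)) flipK mulmx1 reflK.
rewrite [X in kmul _ X]kmulA.
rewrite (_ : kmul (kdiag _) (kdiag _) = kmap C id) ?kmul1l.
  rewrite one_semM (_ : (fun t => _) = on_u (fun k => refl C m k *m refl C m k)).
    by rewrite one_on_u1 // => k; rewrite reflK.
  by apply: functional_extensionality => l; rewrite on_uM.
apply: functional_extensionality => y; apply: functional_extensionality => x.
rewrite kmul_diag /kdiag /kmap /=; case: eqP => [->|_]; rewrite ?mul0r ?mulr0 // mul1r.
by rewrite /phase -big_split big1 //= => l _; case: ifP; rewrite ?mulr1 // mulVf.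
Qed.

Section Correct.
Variables (V : seq (seq (mgate X))) (D : X -> C) (zeta : state T -> T -> C).
Hypothesis oV : all (@one_way X) V.
Hypothesis Dn : forall l, D l != 0.

Definition zflip (s : state T) : state T := [ffun t => s t (+) (zeta s t != 1)].

Hypothesis zeta1 : forall s t, zeta s t ^+ m.+1 = 1.
Hypothesis zeta_flip : forall s, zeta (zflip s) = zeta s.
(** Only states that agree with the input outside the registers have a nonzero amplitude when the
    phases are applied. *)
Hypothesis phaseE : forall s z, (forall l : X, uidx l.2 = None -> z l = emb m s l) ->
  phase V D z = \prod_t zeta s t ^+ leading (fun k => z (t, ureg k)).

Let K := csem (half V D (refl C m) Frefl).

Lemma ampE y x : K y x = \sum_z one_sem (on_u Frefl) y z *
  (phase V D z * one_sem (on_u (refl C m)) z x).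
Proof.
by rewrite /K csem_half // /kmul; apply: eq_bigr => z _; rewrite -kmul_diag.
Qed.

Lemma one_on_u_neq0 A z x : one_sem (on_u A) z x != 0 ->
  forall l : X, uidx l.2 = None -> z l = x l.
Proof.
move=> nz l ul; apply/eqP; apply: contraNT nz => ne.
by rewrite /one_sem (bigD1 l) //= /on_u ul mxE bidx_eq (negbTE ne) mul0r.
Qed.

(** [V] may compute jointly for all registers, but the resulting phase is a product over [t]; so the
    registers have independent amplitudes. *)
Lemma amp_factor s y : K y (emb m s) =
  \prod_t \sum_(v : {ffun reg m -> bool})
    (\prod_(w : reg m) (on_u Frefl (t, w) (bidx (y (t, w))) (bidx (v w)) *
              on_u (refl C m) (t, w) (bidx (v w)) (bidx (emb m s (t, w))))) *
    zeta s t ^+ leading (v \o @ureg m).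
Proof.
rewrite bigA_distr_bigA /= ampE.
pose cur (h : {ffun T -> {ffun reg m -> bool}}) : state X := [ffun l : X => h l.1 l.2].
pose unc (z : state X) : {ffun T -> {ffun reg m -> bool}} :=
  [ffun t => [ffun w => z (t, w)]].
rewrite (reindex cur); last first.
  exists unc => [h _|z _].
    by apply/ffunP => t; apply/ffunP => w; rewrite !ffunE.
  by apply/ffunP => -[t w]; rewrite !ffunE.
apply: eq_bigr => h _; rewrite big_split /=.
(* A term in which a line outside the registers has changed is zero on both sides; the others fall
   under [phaseE]. *)
have [e0|/one_on_u_neq0 ag] := eqVneq (one_sem (on_u (refl C m)) (cur h) (emb m s)) 0.
  rewrite e0 !mulr0 [X in X * _](_ : _ = 0) ?mul0r //.
  under eq_bigr => t _ do rewrite big_split /=.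
  rewrite big_split /= [X in _ * X](_ : _ = 0) ?mulr0 // -e0 /one_sem prod_ext.
  by apply: eq_bigr => t _; apply: eq_bigr => w _; rewrite !ffunE.
rewrite (phaseE ag) mulrCA mulrC; congr (_ * _).
  rewrite /one_sem !prod_ext -big_split; apply: eq_bigr => t _.
  by rewrite -big_split; apply: eq_bigr => w _ /=; rewrite !ffunE.
apply: eq_bigr => t _; congr (_ ^+ leading _).
by apply: functional_extensionality => k; rewrite /= ffunE.
Qed.

(** The two square roots multiply to the probability of [b]. Hence the amplitude of an all-ones
    register is a mean. *)
Lemma Frefl_refl k b : Frefl k (bidx true) (bidx b) * refl C m k (bidx b) (bidx false) =
  if b then pr C m k else 1 - pr C m k.
Proof.
rewrite {1}/Frefl mulmx_bidx big_bool /= !mxE !bidx_eq /= mul0r add0r mul1r.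
case: b => /=; first by rewrite -expr2 sqrtCK.
by rewrite inordK // expr0 mul1r -expr2 sqrtCK.
Qed.

(** If zeta is 1, no phase intervenes and the two rotations compose to NOT. Otherwise the amplitude
    of the all-ones register is the mean that [expect_leading] shows to vanish. *)
Lemma amp_support s y : K y (emb m s) != 0 ->
  (forall l : X, uidx l.2 = None -> y l = emb m s l) /\
  forall t, [forall k, y (t, ureg k)] = (zeta s t == 1).
Proof.
rewrite amp_factor => nz.
have ag l : uidx l.2 = None -> y l = emb m s l.
  case: l => t w ul; apply/eqP; apply: contraNT nz => ne.
  rewrite (bigD1 t) //= big1 ?mul0r // => v _.
  rewrite (bigD1 w) //= {1 2}/on_u ul !mxE !bidx_eq.
  case: (eqVneq (y (t, w)) (v w)) ne => [->|_ _]; last by rewrite !mul0r.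
  by move/negbTE=> ->; rewrite mulr0 !mul0r.
split=> // t; have [z1|zn1] := eqVneq (zeta s t) 1; last first.
  apply: contraNF nz => /forallP yt; rewrite (bigD1 t) //=.
  rewrite (expect_leading (G := fun w b =>
    on_u Frefl (t, w) (bidx (y (t, w))) (bidx b) *
    on_u (refl C m) (t, w) (bidx b) (bidx (emb m s (t, w))))) ?mul0r //.
    move=> w; have := @ag (t, w); rewrite /on_u; case E: (uidx w) (uidxP w) => [k|] /=.
      by case=> <- _; rewrite yt ffunE /= !Frefl_refl addrC subrK.
    move=> _ ->; rewrite // !mxE !bidx_eq.
    by case: (emb _ _ _); rewrite /= ?mulr0 ?mulr1 ?addr0 ?add0r.
  by move=> k; rewrite /on_u /= yt ffunE /= Frefl_refl.
apply/forallP => k; apply: contraNT nz => ny; rewrite (bigD1 t) //=.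
rewrite (_ : \sum_(v : {ffun _}) _ = 0) ?mul0r //; under eq_bigr do rewrite z1 expr1n mulr1.
rewrite -(bigA_distr_bigA (fun w b => on_u Frefl (t, w) (bidx (y (t, w))) (bidx b) *
    on_u (refl C m) (t, w) (bidx b) (bidx (emb m s (t, w))))) /=.
rewrite (bigD1 (ureg k)) //= -mulmx_bidx /on_u /= /Frefl -mulmxA reflK mulmx1.
by rewrite mxE bidx_eq (negbTE ny) ffunE /= mul0r.
Qed.

Definition upd (P : pred T) z : state X :=
  [ffun l : X => if l.2 is None then z l (+) P l.1 else z l].

Lemma updK P : involutive (upd P).
Proof.
by move=> z; apply/ffunP => -[t [w|]]; rewrite !ffunE //= -addbA addbb addbF.
Qed.

Lemma one_on_u_upd P A z x :
  one_sem (on_u A) (upd P z) (upd P x) = one_sem (on_u A) z x.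
Proof.
apply: eq_bigr => -[t [w|]] _; rewrite !ffunE //= /on_u /= !mxE !bidx_eq.
by case: (P t) (z _) (x _) => [] [] [].
Qed.

Lemma emb_zflip s : emb m (zflip s) = upd (fun t => zeta s t != 1) (emb m s).
Proof. by apply/ffunP => -[t [w|]]; rewrite !ffunE //= ffunE. Qed.

(** By [zeta_flip] the phases are the same before and after the targets change, so the toggle
    commutes with the first half. *)
Lemma amp_upd s y :
  K (upd (fun t => zeta s t != 1) y) (emb m (zflip s)) = K y (emb m s).
Proof.
set P := fun t => _; have uI := inv_bij (@updK P).
rewrite !ampE (reindex (upd P)) /=; last exact: onW_bij.
apply: eq_bigr => z _; rewrite emb_zflip !one_on_u_upd; congr (_ * _).
have [->|/one_on_u_neq0 ag] := eqVneq (one_sem (on_u (refl C m)) z (emb m s)) 0.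
  by rewrite !mulr0.
congr (_ * _); rewrite (phaseE ag) (phaseE (s := zflip s)) => [|l ul].
  by rewrite zeta_flip; apply: eq_bigr => t _; congr (_ ^+ leading _);
     apply: functional_extensionality => k; rewrite ffunE.
rewrite emb_zflip; case: l ul => t [w|] ul; rewrite !ffunE /=.
  by rewrite ag // ffunE.
by rewrite ag // ffunE.
Qed.

Lemma uniq_tgts (k : nat) (cs : T -> seq X) :
  uniq (map snd [seq (k, cs t, (t, None) : X) | t <- enum T]).
Proof. by rewrite -map_comp map_inj_uniq ?enum_uniq // => t t' []. Qed.

Lemma cmap_main (k : nat) (cs : T -> seq X) z :
  cmap [seq (k, cs t, (t, None) : X) | t <- enum T] z =
  upd (fun t => fires k (map z (cs t))) z.
Proof.
apply/ffunP => -[t [w|]].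
  rewrite cmap_notin ?ffunE //; apply/mapP => -[g /mapP[t' _ ->]].
  by case.
rewrite (cmap_in _ (g := (k, cs t, (t, None)))) ?uniq_tgts ?map_f ?mem_enum //.
by rewrite ffunE.
Qed.

Lemma toggleE z : cmap nots (cmap tofs z) =
  upd (fun t => ~~ [forall k, z (t, ureg k)]) z.
Proof.
rewrite /tofs cmap_main /nots cmap_main; apply/ffunP => -[t [w|]]; rewrite !ffunE //=.
rewrite -addbA addbT; congr (_ (+) ~~ _).
rewrite -map_comp; apply/allP/forallP => /= h.
  by move=> k; apply: h; apply/mapP; exists k; rewrite ?mem_enum.
by move=> _ /mapP[k _ ->] /=.
Qed.

Theorem sim_gadget : sim (emb m) (emb m) (kmap C zflip) (csem (gadget V D)).
Proof.
move=> s y; rewrite /kmap sum_deltar /gadget csem_cat -/K csem_cat.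
set K' := csem (half _ (fun l => (D l)^-1) _ _).
rewrite /= kmul1l kmap_comp -kmulA.
pose P t := zeta s t != 1; have uI := inv_bij (@updK P).
(* A toggle between the halves amounts to a toggle before both of them, where the halves cancel. *)
transitivity (kmul K' K y (emb m (zflip s))); last first.
  by rewrite /K /K' csem_halfK.
rewrite [RHS]/kmul (reindex (upd P)) /=; last exact: onW_bij.
rewrite kmulA -[LHS]/(\sum_z kmul K' (kmap C (cmap nots \o cmap tofs)) y z * K z (emb m s)).
apply: eq_bigr => z _; rewrite kmul_mapr amp_upd.
have [->|/amp_support[_ sz]] := eqVneq (K z (emb m s)) 0; first by rewrite !mulr0.
congr (K' _ _ * _); rewrite /= toggleE; apply/ffunP => -[t [w|]]; rewrite !ffunE //=.
by rewrite sz.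
Qed.

End Correct.
End Gadget.

(** * Computing work bits, one slot at a time *)

Section Steps.
Variables (T : finType) (m : nat).
Notation X := (ext T m).

(* One gate for each line [t] and index [k], all of the same kind and all
   writing into the slot [sslot]; there is one layer for each [k]. *)
Record step := Step {
  skind : nat; sslot : slot; sctrl : T -> 'I_m.+1 -> seq X }.

Definition slotof (l : X) : option slot := omap fst l.2.
Definition step_layer p k : seq (mgate X) :=
  [seq (skind p, sctrl p t k, (t, Some (sslot p, k)) : X) | t <- enum T].
Definition step_layers p := [seq step_layer p k | k <- enum 'I_m.+1].
Definition step_ok p := forall t k l, l \in sctrl p t k -> slotof l != Some (sslot p).
Definition run p (z : state X) : state X :=
  [ffun l : X => if l.2 is Some (s, k) then
     z l (+) ((s == sslot p) && fires (skind p) (map z (sctrl p l.1 k))) else z l].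

Lemma cmap_step p k (z : state X) : cmap (step_layer p k) z =
  [ffun l : X => if l.2 is Some (s, j) then
     z l (+) ((s == sslot p) && (j == k) && fires (skind p) (map z (sctrl p l.1 k)))
   else z l].
Proof.
apply/ffunP => -[t [[s j]|]]; rewrite [RHS]ffunE /=; last first.
  by rewrite cmap_notin //; apply/mapP => -[g /mapP[t' _ ->]].
case: (altP (s =P _)) => [->|ns] /=; last first.
  rewrite addbF cmap_notin //; apply/mapP => -[g /mapP[t' _ ->]] /= [_ e _].
  by rewrite e eqxx in ns.
case: (altP (j =P _)) => [->|ns] /=; last first.
  rewrite addbF cmap_notin //; apply/mapP => -[g /mapP[t' _ ->]] /= [_ e].
  by rewrite e eqxx in ns.
rewrite (cmap_in _ (g := (skind p, sctrl p t k, (t, Some (sslot p, k))))) //.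
  by rewrite -map_comp map_inj_uniq ?enum_uniq // => t1 t2 [].
by rewrite map_f ?mem_enum.
Qed.

(** No control lies in the slot being written, so the successive layers have the effect of one
    simultaneous assignment. *)
Lemma vmap_step p (z : state X) : step_ok p -> vmap (step_layers p) z = run p z.
Proof.
move=> ok; rewrite /step_layers.
suff e (ks : seq 'I_m.+1) : uniq ks -> vmap [seq step_layer p k | k <- ks] z =
  [ffun l : X => if l.2 is Some (s, j) then
     z l (+) ((s == sslot p) && (j \in ks) && fires (skind p) (map z (sctrl p l.1 j)))
   else z l].
  rewrite e ?enum_uniq //; apply/ffunP => -[t [[s k]|]]; rewrite !ffunE //=.
  by rewrite mem_enum andbT.
elim/last_ind: ks => [|ks k IH].
  by move=> _; apply/ffunP => -[t [[s k]|]]; rewrite !ffunE //= andbF addbF.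
rewrite rcons_uniq => /andP[nin /IH e]; rewrite map_rcons /vmap -cats1 foldl_cat /=.
rewrite -/(vmap _ z) e cmap_step; apply/ffunP => -[t [[s j]|]]; rewrite !ffunE //=.
rewrite mem_rcons inE -addbA; congr (_ (+) _).
case: (altP (j =P k)) => [->|]; last by rewrite !andbF addbF.
rewrite (negbTE nin) !andbF /= !andbT; congr (_ && fires _ _).
apply/eq_in_map => l /ok; case: l => t' [[s' k']|] /= ns; rewrite ffunE //=.
by rewrite (_ : s' == _ = false) ?addbF //; apply: contraNF ns => /eqP ->.
Qed.

Lemma one_way_step p k : step_ok p -> one_way (step_layer p k).
Proof.
move=> ok; apply/allP => g /mapP[t _ ->]; apply/allP => g' /mapP[t' _ ->] /=.
by apply/negP => /ok; rewrite eqxx.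
Qed.

Definition run_all ps z := foldl (fun z p => run p z) z ps.
Definition steps_layers ps := flatten (map step_layers ps).

Fixpoint each (P : step -> Prop) ps := if ps is p :: ps' then P p /\ each P ps' else True.

Lemma vmap_steps ps (z : state X) : each step_ok ps ->
  vmap (steps_layers ps) z = run_all ps z.
Proof.
elim: ps z => //= p ps IH z [ok oks].
by rewrite /vmap foldl_cat -/(vmap _ z) vmap_step // -/(vmap _ _) IH.
Qed.

Lemma all_steps (P : pred (seq (mgate X))) ps :
  each (fun p => forall k, P (step_layer p k)) ps -> all P (steps_layers ps).
Proof.
elim: ps => //= p ps IH [ok oks]; rewrite /steps_layers /= all_cat IH // andbT.
by apply/allP => gs /mapP[k _ ->]; apply: ok.
Qed.

Lemma one_way_steps ps : each step_ok ps -> all (@one_way X) (steps_layers ps).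
Proof.
move=> ok; apply: all_steps; elim: ps ok => //= p ps IH [okp /IH oks].
by split=> // k; apply: one_way_step.
Qed.

Lemma size_steps ps : size (steps_layers ps) = (size ps * m.+1)%N.
Proof.
elim: ps => //= p ps IH; rewrite /steps_layers /= size_cat -/(steps_layers ps) IH.
by rewrite size_map size_enum_ord mulSn.
Qed.

End Steps.

(** Roles of the slots: [sv] holds f(u) in unary, [so] constant ones or copies of f(u), [sb] residue
    indicators, and [se] the bits that receive phases. The register u itself is the slot
    [(true, true, true)]. *)
Definition sv : slot := (true, true, false).
Definition so : slot := (true, false, true).
Definition sb : slot := (true, false, false).
Definition se : slot := (false, true, true).

(** The conjunction over each prefix of u; their number of ones is f(u). *)
Definition vstep (T : finType) m := @Step T m 0 sv
  (fun t k => [seq (t, ureg i) | i : 'I_m.+1 <- enum 'I_m.+1 & (i <= k)%N]).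

Lemma count_map_sum (I : Type) (z : I -> bool) (s : seq I) :
  count id (map z s) = (\sum_(l <- s) z l)%N.
Proof. by elim: s => [|l s IH] /=; rewrite ?big_nil // big_cons IH. Qed.

Lemma all_ureg (T : finType) m (z : state (ext T m)) t (k : 'I_m.+1) :
  all id (map z [seq (t, ureg i) | i : 'I_m.+1 <- enum 'I_m.+1 & (i <= k)%N]) =
  [forall (i : 'I_m.+1 | (i <= k)%N), z (t, ureg i)].
Proof.
rewrite !all_map all_filter; apply/allP/forallP => /= h k'; first by rewrite h ?mem_enum.
by move=> _; apply: h.
Qed.

Lemma prod_slot (C : numClosedFieldType) m (s0 : slot) (a : C) (F : 'I_m.+1 -> C) :
  \prod_(w : reg m) (if w is Some (s, k) then (if s == s0 then F k else 1) else a) =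
  a * \prod_k F k.
Proof.
rewrite (bigD1 None) //=; congr (_ * _).
rewrite (bigID (fun w : reg m => if w is Some (s, k) then s == s0 else false)) /=.
rewrite [X in _ * X]big1 ?mulr1; last by move=> [[s k]|] //= /negbTE ->.
rewrite (reindex_omap (fun k => Some (s0, k)) (fun w : reg m => omap snd w)); last first.
  by move=> [[s k]|] //= /eqP ->.
by apply: eq_big => k; rewrite /= !eqxx.
Qed.

(* The phase [z ^+ j] is collected for every [j] except the one with
   [j = - n] modulo [m.+1]. *)
Lemma character_from_indicators (C : numClosedFieldType) m (z : C) n :
  z ^+ m.+1 = 1 ->
  \prod_(j < m.+1) (if ((n + j) %% m.+1 != 0)%N then z ^+ j else 1) =
  (\prod_(j < m.+1) z ^+ j) * z ^+ n.
Proof.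
move=> z1; have jm : ((m.+1 - n %% m.+1) %% m.+1 < m.+1)%N by rewrite ltn_pmod.
have e0 : ((n + Ordinal jm) %% m.+1 = 0)%N.
  by rewrite /= modnDmr -modnDml subnKC ?modnn // ltnW // ltn_pmod.
rewrite (bigD1 (Ordinal jm)) // [in RHS](bigD1 (Ordinal jm)) //= e0 /= mul1r.
rewrite mulrAC -exprD addnC (divn_eq (n + _) m.+1) e0 addn0 mulnC exprM z1 expr1n mul1r.
apply: eq_bigr => j nj; case: eqP => //= ej; case/eqP: nj; apply/val_inj => /=.
have : (n + j == n + Ordinal jm %[mod m.+1])%N by rewrite ej e0.
by rewrite eqn_modDl => /eqP; rewrite !modn_small ?ltn_ord.
Qed.
Section StepValues.
Variables (T : finType) (m : nat).
Notation X := (ext T m).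

Lemma run_other (p : step T m) (z : state X) l :
  slotof l != Some (sslot p) -> run p z l = z l.
Proof.
case: l => t [[s k]|] ns; rewrite ffunE //=.
by rewrite (_ : s == _ = false) ?addbF //; apply: contraNF ns => /eqP ->.
Qed.

Lemma run_at (p : step T m) (z : state X) t k :
  run p z (t, Some (sslot p, k)) =
  z (t, Some (sslot p, k)) (+) fires (skind p) (map z (sctrl p t k)).
Proof. by rewrite ffunE /= eqxx. Qed.

Definition off_u (s : state T) (z : state X) :=
  forall l : X, uidx l.2 = None -> z l = emb m s l.

Lemma vstep_at s z t k : off_u s z -> run (vstep T m) z (t, Some (sv, k)) =
  [forall (i : 'I_m.+1 | (i <= k)%N), z (t, ureg i)].
Proof. by move=> zs; rewrite run_at zs // ffunE /= all_ureg. Qed.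

Lemma sum_vstep s z t : off_u s z ->
  (\sum_k run (vstep T m) z (t, Some (sv, k)))%N = leading (fun k => z (t, ureg k)).
Proof. by move=> zs; apply: eq_bigr => k _; rewrite (vstep_at _ _ zs). Qed.

Lemma vstep_ok : step_ok (vstep T m).
Proof. by move=> t k l /mapP[i _ ->]. Qed.

End StepValues.

(** * Fan-out from MOD gates *)

Section FanoutFromMod.
Variables (C : numClosedFieldType) (T : finType) (m : nat) (w : C).
Hypotheses (w1 : w ^+ m.+1 = 1) (wn1 : w != 1).
Variable ctl : T -> option T.
Hypothesis ctlP : forall t c, ctl t = Some c -> ctl c = None.
Notation X := (ext T m).

Definition fan_map (s : state T) : state T :=
  [ffun t => s t (+) (if ctl t is Some c then s c else false)].

(** A Toffoli gate without controls is a NOT; this supplies constant ones. *)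
Definition ostep := @Step T m 0 so (fun _ _ => [::]).
(** The inputs are the unary values of all registers governed by [c], followed by [j] ones that
    shift the residue to be tested. *)
Definition bstep := @Step T m m.+1 sb (fun c j =>
  [seq (t, Some (sv, k)) | t <- [seq t <- enum T | ctl t == Some c], k <- enum 'I_m.+1]
  ++ [seq (c, Some (so, i)) | i <- [seq i : 'I_m.+1 <- enum 'I_m.+1 | (i < j)%N]]).
Definition estep := @Step T m 0 se (fun c j => [:: (c, None); (c, Some (sb, j))]).
Definition fan_steps := [:: vstep T m; ostep; bstep; estep].

Definition fan_total : C := \prod_(j < m.+1) w ^+ j.
(** The factor on the control cancels the constant of [character_from_indicators]. Both appear
    exactly when the control is 1, owing to the conjunction in [estep]. *)
Definition fan_phase (l : X) : C :=
  if l.2 is Some (s, j) then (if s == se then w ^+ j else 1) else fan_total^-1.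
Definition fan_zeta (s : state T) t : C := if ctl t is Some c then w ^+ s c else 1.

Let w0 : w != 0.
Proof. by apply: contra_eqN w1 => /eqP ->; rewrite expr0n /= eq_sym oner_eq0. Qed.

Lemma fan_phase_neq0 l : fan_phase l != 0.
Proof.
rewrite /fan_phase; case: l => t [[s j]|] /=.
  by case: ifP; rewrite ?oner_eq0 ?expf_neq0.
by rewrite invr_eq0; apply/prodf_neq0 => j _; rewrite expf_neq0.
Qed.

Lemma fan_steps_ok : each (@step_ok T m) fan_steps.
Proof.
split; first exact: vstep_ok.
split; first by [].
split; last by split => // t k l; rewrite !inE => /orP[] /eqP ->.
move=> t k l; rewrite mem_cat => /orP[/allpairsP[[t' k'] [_ _ ->]]|/mapP[i _ ->]] //.
Qed.

Lemma fan_zflip : zflip fan_zeta = fan_map.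
Proof.
apply: functional_extensionality => s; apply/ffunP => t; rewrite !ffunE /fan_zeta.
by case: (ctl t) => [c|]; rewrite ?eqxx //; case: (s c); rewrite ?expr1 ?expr0 ?wn1 ?eqxx.
Qed.

Lemma fan_zeta_inv s : fan_zeta (zflip fan_zeta s) = fan_zeta s.
Proof.
apply: functional_extensionality => t; rewrite fan_zflip /fan_zeta.
by case E: (ctl t) => [c|] //; rewrite ffunE (ctlP E) addbF.
Qed.

Lemma fan_run s z c : off_u s z -> let z' := run_all fan_steps z in
  z' (c, None) = s c /\ forall j, z' (c, Some (se, j)) =
    s c && ((\sum_(t | ctl t == Some c) leading (fun k => z (t, ureg k)) + j)
              %% m.+1 != 0)%N.
Proof.
move=> zs; rewrite /run_all /=; split; first by rewrite !run_other // zs // ffunE.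
move=> j; rewrite run_at !run_other // zs // ffunE /= andbT.
congr (_ && _); first by rewrite !run_other // zs // ffunE.
rewrite run_at !run_other // zs // ffunE /= map_cat count_cat !count_map_sum.
congr (_ %% _ != 0)%N; congr (_ + _)%N.
  rewrite big_allpairs_dep big_filter big_enum_cond; apply: eq_bigr => t _.
  rewrite big_enum -(sum_vstep t zs); apply: eq_bigr => k _.
  by rewrite (run_other (p := ostep)).
rewrite big_map big_filter big_enum_cond /=.
rewrite (eq_bigr (fun=> 1%N)) => [|i _]; last first.
  by rewrite (run_at ostep) run_other // zs // ffunE.
by rewrite -(big_ord_widen m.+1 (fun=> 1%N)) ?sum1_card ?card_ord // ltnW.
Qed.

Lemma fan_phaseE s z : off_u s z -> phase (steps_layers fan_steps) fan_phase z =
  \prod_t fan_zeta s t ^+ leading (fun k => z (t, ureg k)).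
Proof.
move=> zs; rewrite /phase vmap_steps; last exact: fan_steps_ok.
rewrite prod_ext; pose f t := leading (fun k => z (t, ureg k)).
(* The targets are grouped by their control, because the indicators of [c] see only the sum of the
   values of its targets. *)
transitivity (\prod_c \prod_(t | ctl t == Some c) w ^+ (s c * f t)%N); last first.
  rewrite (exchange_big_dep xpredT) //=; apply: eq_bigr => t _; rewrite /fan_zeta.
  case: (ctl t) => [c|]; last by rewrite big_pred0 ?expr1n.
  by rewrite (big_pred1 c) ?exprM // => c'; rewrite /= eq_sym.
apply: eq_bigr => c _; have [zc ze] := fan_run c zs.
rewrite (eq_bigr (fun v : reg m => if v is Some (s', j) then (if s' == se then
    (if s c && ((\sum_(t | ctl t == Some c) f t + j) %% m.+1 != 0)%N
     then w ^+ j else 1) else 1) else if s c then fan_total^-1 else 1)) => [|v _]; last first.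
  case: v => [[s' j]|]; rewrite /fan_phase /= ?zc //.
  by case: eqP => [->|_]; rewrite ?ze // if_same.
rewrite prod_slot; case: (s c) => /=; last by rewrite !big1 ?mulr1.
under [in RHS]eq_bigr do rewrite mul1n.
rewrite character_from_indicators // mulKf ?prodrXr //.
by rewrite -invr_eq0; apply: (fan_phase_neq0 (c, None)).
Qed.

Theorem sim_fan : sim (emb m) (emb m) (kmap C fan_map)
  (csem (gadget (steps_layers fan_steps) fan_phase)).
Proof.
rewrite -fan_zflip; apply: sim_gadget.
- exact: one_way_steps fan_steps_ok.
- exact: fan_phase_neq0.
- move=> s t; rewrite /fan_zeta; case: (ctl t) => [c|]; rewrite ?expr1n //.
  by rewrite exprAC w1 expr1n.
- exact: fan_zeta_inv.
- exact: fan_phaseE.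
Qed.

End FanoutFromMod.

(** * MOD gates from fan-out *)

Section ModFromFanout.
Variables (C : numClosedFieldType) (T : finType) (m : nat) (w : C).
Hypothesis wP : m.+1.-primitive_root w.
Variable own : T -> option T.
Hypothesis ownP : forall y t, own y = Some t -> own t = None.
Notation X := (ext T m).

Definition modq_map (s : state T) : state T :=
  [ffun t => s t (+) ((\sum_(y | own y == Some t) s y) %% m.+1 != 0)%N].

(* Lines without owner copy an irrelevant bit, which receives no phase. *)
Definition cstep := @Step T m 0 so (fun y k => [:: (odflt y (own y), Some (sv, k))]).
(** For an owned input these bits sum to [y * f(u)], with u the register of its target. A phase [w]
    on each gives the share of [y] in the total phase. *)
Definition astep := @Step T m 0 se (fun y k => [:: (y, None); (y, Some (so, k))]).
Definition mod_steps := [:: vstep T m; cstep; astep].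

Definition mod_phase (l : X) : C :=
  if l.2 is Some (s, j) then
    (if s == se then (if own l.1 is Some _ then w else 1) else 1) else 1.
Definition mod_zeta (s : state T) t : C := w ^+ (\sum_(y | own y == Some t) s y)%N.

Lemma mod_phase_neq0 l : mod_phase l != 0.
Proof.
rewrite /mod_phase; case: l => t [[s j]|] /=; rewrite ?oner_eq0 //.
case: ifP => // _; case: (own t) => [_|]; rewrite ?oner_eq0 //.
apply: contra_eqN (prim_expr_order wP) => /eqP ->.
by rewrite expr0n /= eq_sym oner_eq0.
Qed.

Lemma mod_steps_ok : each (@step_ok T m) mod_steps.
Proof.
split; first exact: vstep_ok.
split; first by move=> t k l; rewrite inE => /eqP ->.
by split => // t k l; rewrite !inE => /orP[] /eqP ->.
Qed.

(** Here [w] must be primitive: its power is 1 exactly when the exponent is divisible by the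
    modulus. *)
Lemma mod_zflip : zflip mod_zeta = modq_map.
Proof.
apply: functional_extensionality => s; apply/ffunP => t; rewrite !ffunE /mod_zeta.
by rewrite -(prim_order_dvd wP).
Qed.

Lemma mod_zeta_inv s : mod_zeta (zflip mod_zeta s) = mod_zeta s.
Proof.
apply: functional_extensionality => t; rewrite mod_zflip /mod_zeta; congr (_ ^+ _).
apply: eq_bigr => y /eqP e; rewrite ffunE big_pred0 ?mod0n ?addbF // => y'.
by apply/eqP => /ownP; rewrite e.
Qed.

Lemma mod_run s z y t k : off_u s z -> own y = Some t ->
  run_all mod_steps z (y, Some (se, k)) =
  s y && run (vstep T m) z (t, Some (sv, k)).
Proof.
move=> zs e; rewrite /run_all /=; set z1 := run (vstep T m) z.
have z1E l : uidx l.2 = None -> slotof l != Some sv -> z1 l = emb m s l.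
  by move=> ul sl; rewrite /z1 run_other // zs.
have e0 : run cstep z1 (y, None) = s y by rewrite run_other // z1E // ffunE.
have e1 : run cstep z1 (y, Some (se, k)) = false by rewrite run_other // z1E // ffunE.
rewrite (run_at astep) /= e0 e1 /= andbT; congr (_ && _).
by rewrite (run_at cstep) /= e /= andbT z1E // ffunE.
Qed.

Lemma mod_phaseE s z : off_u s z -> phase (steps_layers mod_steps) mod_phase z =
  \prod_t mod_zeta s t ^+ leading (fun k => z (t, ureg k)).
Proof.
move=> zs; rewrite /phase vmap_steps; last exact: mod_steps_ok.
rewrite prod_ext; pose f t := leading (fun k => z (t, ureg k)).
transitivity (\prod_t \prod_(y | own y == Some t) w ^+ (s y * f t)%N); last first.
  apply: eq_bigr => t _; rewrite /mod_zeta -exprM big_distrl /=.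
  by rewrite prodrXr.
rewrite [RHS](exchange_big_dep xpredT) //=; apply: eq_bigr => y _.
pose F k := if own y is Some t then
  w ^+ (s y && run (vstep T m) z (t, Some (sv, k)) : nat) else 1.
rewrite (eq_bigr (fun v : reg m => if v is Some (s', k) then
   (if s' == se then F k else 1) else 1)) => [|v _]; last first.
  case: v => [[s' k]|]; rewrite /mod_phase /= ?if_same //; case: eqP => [->|_].
    rewrite /F; case e: (own y) => [t|]; rewrite ?if_same //.
    by rewrite (mod_run _ zs e); case: (_ && _).
  by rewrite if_same.
rewrite prod_slot mul1r /F; case: (own y) => [t|]; last first.
  by rewrite [RHS]big_pred0 ?big1_eq.
rewrite (big_pred1 t) => [|t']; last by rewrite /= eq_sym.
rewrite prodrXr; congr (_ ^+ _); rewrite /f -(sum_vstep t zs) big_distrr /=.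
by apply: eq_bigr => k _; case: (s y); rewrite ?mul1n ?mul0n.
Qed.

Theorem sim_mod : sim (emb m) (emb m) (kmap C modq_map)
  (csem (gadget (steps_layers mod_steps) mod_phase)).
Proof.
rewrite -mod_zflip; apply: sim_gadget.
- exact: one_way_steps mod_steps_ok.
- exact: mod_phase_neq0.
- by move=> s t; rewrite /mod_zeta exprAC (prim_expr_order wP) expr1n.
- exact: mod_zeta_inv.
- exact: mod_phaseE.
Qed.

End ModFromFanout.

(** * From gate lists to control and ownership maps *)

Section GateLists.
Variable T : finType.
Implicit Types (gs : seq (mgate T)) (g : mgate T).

Lemma eq_of_tgt gs g g' : uniq (map snd gs) -> g \in gs -> g' \in gs ->
  g.2 = g'.2 -> g = g'.
Proof.
elim: gs => //= h gs IH /andP[nin uq]; rewrite !inE => /orP[/eqP->|gi] /orP[/eqP->|gi'] e //.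
- by case/mapP: nin; exists g'.
- by case/mapP: nin; exists g.
- exact: IH.
Qed.

Lemma eq_of_line K gs g g' l : strict K gs -> g \in gs -> g' \in gs ->
  l \in lines g -> l \in lines g' -> g = g'.
Proof.
case/andP=> _; elim: gs => //= h gs IH; rewrite cat_uniq => /and3P[_ nh /IH{}IH].
have nin g0 : g0 \in gs -> l \in lines h -> l \in lines g0 -> False.
  move=> gi lh l0; case/hasP: nh; exists l => //.
  by apply/flatten_mapP; exists g0.
rewrite !inE => /orP[/eqP->|gi] /orP[/eqP->|gi'] // lg lg'.
- by case: (nin g').
- by case: (nin g).
- exact: IH.
Qed.

(** In a fan-out layer at most one gate passes the filter. The same is true of [own_of] in a strict
    layer. *)
Definition ctl_of gs (t : T) : option T :=
  ohead [seq head t g.1.2 | g <- gs & g.2 == t].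
Definition own_of gs (y : T) : option T := ohead [seq g.2 | g <- gs & y \in g.1.2].

Lemma ctl_ofP gs t c : ctl_of gs t = Some c ->
  exists2 g, g \in gs & g.2 = t /\ c = head t g.1.2.
Proof.
rewrite /ctl_of; case E: [seq _ <- _ | _] => [|g gs'] //= [<-].
have : g \in [seq g <- gs | g.2 == t] by rewrite E inE eqxx.
by rewrite mem_filter => /andP[/eqP e gi]; exists g.
Qed.

Lemma own_ofP gs y t : own_of gs y = Some t ->
  exists2 g, g \in gs & g.2 = t /\ y \in g.1.2.
Proof.
rewrite /own_of; case E: [seq _ <- _ | _] => [|g gs'] //= [<-].
have : g \in [seq g <- gs | y \in g.1.2] by rewrite E inE eqxx.
by rewrite mem_filter => /andP[e gi]; exists g.
Qed.

Lemma ctl_of_some gs g : g \in gs -> ctl_of gs g.2 <> None.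
Proof.
move=> gi; rewrite /ctl_of; case E: [seq _ <- _ | _] => [|//].
have : g \in [seq g' <- gs | g'.2 == g.2] by rewrite mem_filter eqxx.
by rewrite E.
Qed.

Lemma own_of_some gs g y : g \in gs -> y \in g.1.2 -> own_of gs y <> None.
Proof.
move=> gi yg; rewrite /own_of; case E: [seq _ <- _ | _] => [|//].
have : g \in [seq g' <- gs | y \in g'.1.2] by rewrite mem_filter yg.
by rewrite E.
Qed.

Lemma fanout_ctl gs : fanout gs -> cmap gs = fan_map (ctl_of gs) /\
  forall t c, ctl_of gs t = Some c -> ctl_of gs c = None.
Proof.
case/and3P=> /allP k0 uq ow; have hd g : g \in gs -> g.1.2 = [:: head g.2 g.1.2].
  by move=> /k0 /andP[_]; case: g.1.2 => [|x []].
split=> [|t c /ctl_ofP[g gi [e ec]]].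
  apply: functional_extensionality => s; apply/ffunP => t; rewrite [RHS]ffunE.
  case E: (ctl_of gs t) => [c|].
    have [g gi [e ec]] := ctl_ofP E; rewrite -e cmap_in //; congr (_ (+) _).
    have /andP[/eqP kg _] := k0 _ gi.
    by rewrite /gbit kg hd //= andbT ec e.
  rewrite cmap_notin ?addbF //; apply/mapP => -[g gi e].
  by case: (ctl_of_some gi); rewrite -e.
case E: (ctl_of gs c) => [c'|] //; have [g' gi' [e' _]] := ctl_ofP E.
move/allP: ow => /(_ _ gi') /allP/(_ _ gi); rewrite e' ec hd // inE.
by rewrite -e /= eqxx.
Qed.

Lemma strict_own m gs : strict [:: m.+1] gs -> cmap gs = modq_map m (own_of gs) /\
  forall y t, own_of gs y = Some t -> own_of gs t = None.
Proof.
move=> st; have /andP[ow uq] := strict_one_way st.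
have ownE g y : g \in gs -> (own_of gs y == Some g.2) = (y \in g.1.2).
  move=> gi; apply/eqP/idP => [/own_ofP[g' gi' [e yg]]|yg].
    by rewrite -(eq_of_tgt uq gi' gi e).
  case E: (own_of gs y) (own_of_some gi yg) => [t|] // _.
  have [g' gi' [<- yg']] := own_ofP E; rewrite (eq_of_line st gi gi' (l := y)) //.
    by rewrite mem_rcons inE yg orbT.
  by rewrite mem_rcons inE yg' orbT.
split=> [|y t /own_ofP[g gi [e yg]]]; last first.
  case E: (own_of gs t) => [t'|] //; have [g' gi' [_ tg]] := own_ofP E.
  by move/allP: ow => /(_ _ gi) /allP/(_ _ gi'); rewrite e tg.
apply: functional_extensionality => s; apply/ffunP => t; rewrite [RHS]ffunE.
have [/mapP[g gi ->]|nt] := boolP (t \in map snd gs); last first.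
  rewrite cmap_notin // big_pred0 ?mod0n ?addbF // => y.
  by apply: contraNF nt => /eqP /own_ofP[g gi [<- _]]; apply: map_f.
rewrite cmap_in //; congr (_ (+) _); rewrite /gbit.
have /eqP -> : g.1.1 == m.+1.
  by move/andP: st => [/allP/(_ _ gi)]; rewrite inE.
rewrite /= count_map_sum; congr (_ %% _ != 0)%N.
rewrite (eq_bigl _ _ (fun y => ownE g y gi)) -big_uniq //.
move/andP: st => [_ uf]; elim: gs gi uf {ow uq ownE} => //= h gs IH.
rewrite inE cat_uniq => /orP[/eqP <-|gi] /and3P[ug _ uf]; last exact: IH.
by move: ug; rewrite rcons_uniq => /andP[].
Qed.

Lemma strict_filter K gs (P : pred (mgate T)) : strict K gs -> strict K (filter P gs).
Proof.
case/andP=> aK uf; apply/andP; split.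
  by apply/allP => g; rewrite mem_filter => /andP[_ /(allP aK)].
by apply: subseq_uniq uf; elim: gs {aK} => //= g gs IH; case: ifP => _ /=;
  [apply: cat_subseq|apply: subseq_trans IH _; apply: suffix_subseq].
Qed.

(** The gates chosen by [P] change no control of the remaining ones, so the two groups can act in
    succession. *)
Lemma strict_split K gs (P : pred (mgate T)) : strict K gs ->
  cmap gs = cmap (filter (predC P) gs) \o cmap (filter P gs).
Proof.
move=> st; have /andP[ow _] := strict_one_way st.
apply: functional_extensionality => s; apply/ffunP => t.
rewrite /= [LHS]ffunE [RHS]ffunE [in RHS]ffunE -addbA; congr (_ (+) _).
rewrite (bigID P) /= !big_filter_cond; congr (_ (+) _).
  by apply: eq_bigl => g; rewrite andbC.
rewrite big_seq_cond [RHS]big_seq_cond.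
apply: eq_big => [g|g /andP[gi _]]; first by rewrite [(g.2 == t) && _]andbC.
apply/esym; apply: (cmap_same ow _ gi) => t' nt'.
rewrite cmap_notin //; apply: contra nt' => /mapP[g' + ->].
by rewrite mem_filter => /andP[_ gi']; apply: map_f.
Qed.

End GateLists.

(** * Gate set, disjointness and size of the gadgets *)

Section LayerSets.
Variables (C : numClosedFieldType) (m : nat).

(** Independent of the number of lines, as the class requires of its gate types. *)
Definition gset (Ds : seq C) : seq 'M[C]_2 :=
  1%:M :: [seq refl C m k | k <- iota 0 m.+1] ++ [seq Frefl C m k | k <- iota 0 m.+1]
  ++ [seq reflF C m k | k <- iota 0 m.+1] ++ [seq dmx a | a <- Ds]
  ++ [seq dmx a^-1 | a <- Ds].

Lemma unitary_gset Ds : all (fun a => `|a| == 1) Ds -> all (unitary2 C) (gset Ds).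
Proof.
move/allP=> D1; rewrite /gset -cat1s !all_cat !all_map all_seq1 unitary2_1 andTb.
apply/and5P; split; apply/allP => /= x xi.
- exact: unitary2_refl.
- exact: unitary2_flip.
- exact: unitary2_reflflip.
- by apply: unitary2_dmx; apply/eqP/D1.
- by apply: unitary2_dmx; rewrite normfV (eqP (D1 _ xi)) invr1.
Qed.

Variable T : finType.
Notation X := (ext T m).

Lemma lok_sub S S' P (L : mlayer C T) : {subset S <= S'} -> lok S P L -> lok S' P L.
Proof. by move=> h; case: L => //= U /forallP e; apply/forallP => t; apply: h. Qed.

Lemma lok_lift S K (L : mlayer C T) (P : pred (seq (mgate X))) : 1%:M \in S ->
  (forall gs, strict K gs -> P gs) -> lok S (strict K) L -> lok S P (lift_layer m L).
Proof.
move=> S1 KP; case: L => [U /forallP h|gs /andP[aK uf]] /=.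
  by apply/forallP => -[t [w|]] /=.
apply/KP/andP; split; first by rewrite all_map.
rewrite -map_comp (eq_map (g := map (fun t => (t, None) : X) \o @lines T)).
  rewrite map_comp -map_flatten map_inj_uniq // => t t' [] //.
by move=> g; rewrite /lines /= map_rcons.
Qed.

Lemma lok_on_u (S : seq 'M[C]_2) A : 1%:M \in S ->
  (forall k, (k < m.+1)%N -> A k \in S) -> [forall l : X, on_u A l \in S].
Proof.
move=> S1 h; apply/forallP => -[t w]; rewrite /on_u /=.
by case: (uidx w) => // k; apply: h.
Qed.

Lemma gadget_ok P V D Ds : all P V -> P (tofs T m) -> P (nots T m) ->
  (forall l : X, D l \in Ds) -> all (lok (gset Ds) P) (gadget V D).
Proof.
move=> PV P1 P2 DD.
have aV s : all P s -> all (lok (gset Ds) P) (map (@Cl C X) s) by rewrite all_map.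
rewrite /gadget /half /= !all_cat /= !all_cat /= !aV ?all_rev //= P1 P2 /=.
have kin k : (k < m.+1)%N -> k \in iota 0 m.+1 by rewrite mem_iota.
have hA : forall k, (k < m.+1)%N -> refl C m k \in gset Ds.
  by move=> k /kin ki; rewrite inE !mem_cat map_f ?orbT.
have hB : forall k, (k < m.+1)%N -> Frefl C m k \in gset Ds.
  by move=> k /kin ki; rewrite inE !mem_cat (map_f (Frefl C m)) ?orbT.
have hC : forall k, (k < m.+1)%N -> reflF C m k \in gset Ds.
  by move=> k /kin ki; rewrite inE !mem_cat (map_f (reflF C m)) ?orbT.
have h1 : 1%:M \in gset Ds by rewrite inE eqxx.
have e1 : [forall l, dmx (D l) \in gset Ds].
  by apply/forallP => l; rewrite inE !mem_cat (map_f (@dmx C)) ?orbT.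
have e2 : [forall l, dmx (D l)^-1 \in gset Ds].
  by apply/forallP => l; rewrite inE !mem_cat (map_f (fun a => dmx a^-1)) ?orbT.
by rewrite !lok_on_u //= e1 e2 /= all_cat aV ?all_rev //= lok_on_u.
Qed.

(** Each half runs [V] forwards and backwards and has three one-qubit layers; [tofs] and [nots] are
    the other two. *)
Lemma size_gadget V (D : X -> C) : size (gadget V D) = (4 * size V + 8)%N.
Proof.
rewrite /gadget /half !size_cat /= !size_cat /= !size_cat /= !size_map !size_rev.
by rewrite !addnS !addn0 mulSn !mulSn mul0n addn0 !addnA.
Qed.

Lemma strict_family (K : seq nat) k (lab : X -> option T) (cs : T -> seq X) (tg : T -> X) :
  k \in K -> (forall t, uniq (cs t)) -> (forall t, tg t \notin cs t) ->
  (forall t l, l \in rcons (cs t) (tg t) -> lab l = Some t) ->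
  strict K [seq (k, cs t, tg t) | t <- enum T].
Proof.
move=> kK us nt hl; apply/andP; split; first by rewrite all_map; apply/allP.
rewrite -map_comp; apply: (@uniq_flatten_label _ _ _ _ Some lab).
- exact: enum_uniq.
- by move=> t t' _ _ [].
- by move=> t _; rewrite rcons_uniq nt us.
- by move=> t l _; apply: hl.
Qed.

Lemma strict_tofs K : 0%N \in K -> strict K (tofs T m).
Proof.
move=> K0; apply: (strict_family (lab := fun l => Some l.1)) => // t.
- by rewrite map_inj_uniq ?enum_uniq // => i j [].
- by apply/mapP => -[].
- by move=> l; rewrite mem_rcons inE => /orP[/eqP->|/mapP[i _ ->]].
Qed.

Lemma strict_nots K : 0%N \in K -> strict K (nots T m).
Proof.
move=> K0; apply: (strict_family (lab := fun l => Some l.1)) => // t l.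
by rewrite inE => /eqP ->.
Qed.

Lemma strict_vstep K k : 0%N \in K -> strict K (step_layer (vstep T m) k).
Proof.
move=> K0; apply: (strict_family (lab := fun l => Some l.1)) => // t /=.
- by rewrite map_inj_uniq ?filter_uniq -?enumT ?enum_uniq // => i j [].
- by apply/mapP => -[].
- by move=> l; rewrite mem_rcons inE => /orP[/eqP->|/mapP[i _ ->]].
Qed.

Lemma strict_pair_step K s s' k : 0%N \in K -> s != s' ->
  strict K (step_layer (@Step T m 0 s (fun y k => [:: (y, None); (y, Some (s', k))])) k).
Proof.
move=> K0 ns; apply: (strict_family (lab := fun l => Some l.1)) => // t /=.
- by rewrite inE andbT; apply/eqP => -[].
- by apply/negP; rewrite !inE => /orP[] /eqP // [e]; rewrite e eqxx in ns.
- by move=> l; rewrite !inE => /or3P[] /eqP ->.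
Qed.

Lemma strict_fan_steps (ctl : T -> option T) K : 0%N \in K -> m.+1 \in K ->
  all (strict K) (steps_layers (fan_steps m ctl)).
Proof.
move=> K0 Km; apply: all_steps; split; first by move=> k; apply: strict_vstep.
split.
  move=> k; apply: (strict_family (lab := fun l => Some l.1)) => // t l.
  by rewrite inE => /eqP ->.
split; last by split=> // k; apply: strict_pair_step.
move=> k.
(* A unary bit belongs to the gate of the control of its line, any other bit to the gate of its own
   line. *)
apply: (strict_family (lab := fun l : X => if slotof l == Some sv then ctl l.1 else Some l.1))
  => // t /=.
- rewrite cat_uniq; apply/and3P; split.
  + apply: allpairs_uniq; rewrite ?filter_uniq -?enumT ?enum_uniq //.
    by move=> [t1 k1] [t2 k2] _ _ /= [-> ->].
  + by apply/hasPn => _ /mapP[i _ ->]; apply/negP => /allpairsP[[t' k'] [_ _ []]].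
  + by rewrite map_inj_uniq ?filter_uniq -?enumT ?enum_uniq // => i j [].
- rewrite mem_cat negb_or; apply/andP; split.
    by apply/allpairsP => -[[t' k'] [_ _ []]].
  by apply/mapP => -[].
- move=> l; rewrite mem_rcons inE mem_cat => /orP[/eqP->|] //.
  case/orP=> [/allpairsP[[t' k'] /= [+ _ ->]]|/mapP[i _ ->] //].
  by rewrite mem_filter => /andP[/eqP].
Qed.

(** The step in which a control is shared: one unary bit goes to all inputs of its target. *)
Lemma fanout_copy_step (own : T -> option T) k : fanout (step_layer (cstep m own) k : seq (mgate X)).
Proof.
apply/and3P; split; first by rewrite all_map; apply/allP.
  by rewrite -map_comp map_inj_uniq ?enum_uniq // => t t' [].
by apply: one_way_step => t j l; rewrite inE => /eqP ->.
Qed.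

End LayerSets.

(** * The two translations of layers: MOD gates into fan-out, fan-out into MOD gates *)

Section Passes.
Variable C : numClosedFieldType.

Lemma sim_circuit (T T' : finType) (i : state T -> state T')
    (tr : mlayer C T -> seq (mlayer C T')) (ok : pred (mlayer C T)) :
  (forall L, ok L -> sim i i (lsem L) (csem (tr L))) ->
  forall Ls, all ok Ls -> sim i i (csem Ls) (csem (flatten (map tr Ls))).
Proof.
move=> h; elim=> [_|L Ls IH /= /andP[okL okLs]]; first exact: sim_map.
by rewrite csem_cat; apply: sim_mul; [apply: IH|apply: h].
Qed.

Lemma size_flatten_le (A B : Type) (f : A -> seq B) d s :
  (forall x, (size (f x) <= d)%N) -> (size (flatten (map f s)) <= d * size s)%N.
Proof.
move=> h; elim: s => [|x s IH] /=; first by rewrite muln0.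
by rewrite size_cat mulnS leq_add.
Qed.

Lemma all_flatten_map (A B : Type) (f : A -> seq B) (P : pred A) (Q : pred B) s :
  (forall x, P x -> all Q (f x)) -> all P s -> all Q (flatten (map f s)).
Proof.
move=> h; elim: s => //= x s IH /andP[Px Ps].
by rewrite all_cat h // IH.
Qed.

Lemma norm_root_of_unity (w : C) n : w ^+ n.+1 = 1 -> `|w| = 1.
Proof.
move=> w1; apply/eqP; rewrite -(@pexpr_eq1 _ _ n.+1) ?normr_ge0 //.
by rewrite -normrX w1 normr1.
Qed.

Definition strict_or_fanout (T : finType) (gs : seq (mgate T)) :=
  strict [:: 0%N] gs || fanout gs.

Section ModPass.
Variables (m : nat) (w : C).
Hypothesis wP : m.+1.-primitive_root w.
Variable T : finType.

Definition mod_pass (L : mlayer C T) : seq (mlayer C (ext T m)) :=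
  match L with
  | One _ => [:: lift_layer m L]
  | Cl gs =>
    let own := own_of (filter (predC (fun g : mgate T => g.1.1 == 0%N)) gs) in
    lift_layer m (Cl C (filter (fun g : mgate T => g.1.1 == 0%N) gs)) ::
    gadget (steps_layers (mod_steps m own)) (mod_phase w own)
  end.

Lemma mod_part gs : strict [:: 0%N; m.+1] gs ->
  strict [:: m.+1] (filter (predC (fun g : mgate T => g.1.1 == 0%N)) gs).
Proof.
move=> st; have /andP[aK uf] := strict_filter (predC (fun g => g.1.1 == 0%N)) st.
apply/andP; split=> //; apply/allP => g gi.
have := allP aK _ gi; rewrite !inE => /orP[/eqP e|//].
by move: gi; rewrite mem_filter /= e eqxx.
Qed.

Lemma tof_part gs : strict [:: 0%N; m.+1] gs ->
  strict [:: 0%N] (filter (fun g : mgate T => g.1.1 == 0%N) gs).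
Proof.
move=> st; have /andP[_ uf] := strict_filter (fun g => g.1.1 == 0%N) st.
apply/andP; split=> //; apply/allP => g; rewrite mem_filter inE.
by case/andP.
Qed.

Definition mod_gates : seq 'M[C]_2 := gset m [:: 1; w].

Lemma sim_mod_pass S L : lok S (strict [:: 0%N; m.+1]) L ->
  sim (emb m) (emb m) (lsem L) (csem (mod_pass L)).
Proof.
case: L => [U _|gs st] /=.
  by rewrite kmul1l; exact (sim_lift (One U)).
have [e ownP] := strict_own (mod_part st).
rewrite (strict_split (fun g => g.1.1 == 0%N) st) -kmap_comp.
apply: sim_mul; last exact: (sim_lift (Cl C _)).
by rewrite e; apply: sim_mod.
Qed.

Lemma mod_pass_ok S L : lok S (strict [:: 0%N; m.+1]) L ->
  all (lok (mod_gates ++ S) (@strict_or_fanout _)) (mod_pass L).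
Proof.
have sub1 : {subset S <= mod_gates ++ S} by move=> x xS; rewrite mem_cat xS orbT.
have sub2 : {subset mod_gates <= mod_gates ++ S} by move=> x xS; rewrite mem_cat xS.
have i1 : 1%:M \in mod_gates ++ S by apply: sub2; rewrite inE eqxx.
have s0 (gs : seq (mgate (ext T m))) : strict [:: 0%N] gs -> strict_or_fanout gs.
  by rewrite /strict_or_fanout => ->.
case: L => [U okU|gs st].
  rewrite /mod_pass all_seq1; apply: (@lok_lift _ _ _ _ [:: 0%N]) => //.
  exact: lok_sub okU.
have stm := mod_part st; rewrite /mod_pass.
set own := own_of _; set ga := gadget _ _.
suff h : all (lok mod_gates (@strict_or_fanout _)) ga.
  apply/andP; split.
    by apply: (@lok_lift _ _ _ _ [:: 0%N]) => //; apply: tof_part.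
  by apply: sub_all h => L; apply: lok_sub.
apply: gadget_ok.
- apply: all_steps; split; first by move=> k; apply/s0/strict_vstep.
  split; first by move=> k; apply/orP; right; apply: fanout_copy_step.
  by split=> // k; apply/s0/strict_pair_step.
- exact/s0/strict_tofs.
- exact/s0/strict_nots.
- move=> [t [[s j]|]]; rewrite /mod_phase /= ?inE ?eqxx //.
  by case: ifP => _; [case: (own t) => [_|]|]; rewrite ?eqxx ?orbT.
Qed.

(** Three steps of [m.+1] layers each; the Toffoli part of the layer accounts for the ninth extra
    layer. *)
Lemma size_mod_pass L : (size (mod_pass L) <= 4 * (3 * m.+1) + 9)%N.
Proof.
case: L => [U|gs]; first by rewrite /= addnS.
by rewrite /mod_pass -cat1s size_cat size_gadget size_steps add1n -addnS.
Qed.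

Lemma unitary_mod_gates : all (unitary2 C) mod_gates.
Proof.
apply: unitary_gset; rewrite /= normr1 eqxx andbT /=.
by apply/eqP/norm_root_of_unity/(prim_expr_order wP).
Qed.

End ModPass.

Section FanoutPass.
Variables (m : nat) (w : C).
Hypotheses (w1 : w ^+ m.+1 = 1) (wn1 : w != 1).
Variable T : finType.

Definition fan_pass (L : mlayer C T) : seq (mlayer C (ext T m)) :=
  match L with
  | One _ => [:: lift_layer m L]
  | Cl gs =>
    if strict [:: 0%N] gs then [:: lift_layer m L]
    else gadget (steps_layers (fan_steps m (ctl_of gs))) (fan_phase w (m := m))
  end.

Definition fan_gates : seq 'M[C]_2 :=
  gset m (1 :: (fan_total m w)^-1 :: [seq w ^+ j | j <- iota 0 m.+1]).

Lemma sim_fan_pass S L : lok S (@strict_or_fanout _) L ->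
  sim (emb m) (emb m) (lsem L) (csem (fan_pass L)).
Proof.
case: L => [U _|gs] /=.
  by rewrite kmul1l; exact: (sim_lift (One U)).
rewrite /strict_or_fanout; case: ifP => [_ _|_ /= fo].
  by rewrite /= kmul1l; exact: (sim_lift (Cl C _)).
by have [-> ctlP] := fanout_ctl fo; apply: sim_fan.
Qed.

Lemma fan_pass_ok S L : lok S (@strict_or_fanout _) L ->
  all (lok (fan_gates ++ S) (strict [:: 0%N; m.+1])) (fan_pass L).
Proof.
have sub1 : {subset S <= fan_gates ++ S} by move=> x xS; rewrite mem_cat xS orbT.
have sub2 : {subset fan_gates <= fan_gates ++ S} by move=> x xS; rewrite mem_cat xS.
have i1 : 1%:M \in fan_gates ++ S by apply: sub2; rewrite inE eqxx.
have s0 (gs : seq (mgate (ext T m))) : strict [:: 0%N] gs -> strict [:: 0%N; m.+1] gs.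
  by case/andP=> aK uf; apply/andP; split=> //; apply: sub_all aK => g; rewrite !inE => ->.
case: L => [U okU|gs st]; rewrite /fan_pass.
  by rewrite all_seq1; apply: (@lok_lift _ _ _ _ [:: 0%N]) => //; apply: lok_sub okU.
case: ifP => [h|_].
  by rewrite all_seq1; apply: (@lok_lift _ _ _ _ [:: 0%N]).
set ga := gadget _ _.
suff h : all (lok fan_gates (strict [:: 0%N; m.+1])) ga.
  by apply: sub_all h => L; apply: lok_sub.
apply: gadget_ok.
- by apply: strict_fan_steps; rewrite !inE eqxx ?orbT.
- exact: strict_tofs.
- exact: strict_nots.
- have hj (j : 'I_m.+1) : w ^+ j \in [seq w ^+ j | j <- iota 0 m.+1].
    by apply: (map_f (fun j => w ^+ j)); rewrite mem_iota ltn_ord.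
  move=> [t [[s j]|]]; last first.
    by rewrite -[fan_phase _ _]/((fan_total m w)^-1) 2!in_cons eqxx orbT.
  have -> : fan_phase w (t, Some (s, j)) = if s == se then w ^+ j else 1 by [].
  case: ifP => _; last exact: mem_head.
  by rewrite 2!in_cons hj !orbT.
Qed.

Lemma size_fan_pass L : (size (fan_pass L) <= 4 * (4 * m.+1) + 8)%N.
Proof.
case: L => [U|gs]; first by rewrite /= addnS.
rewrite /fan_pass; case: ifP => _; first by rewrite /= addnS.
by rewrite size_gadget size_steps.
Qed.

Lemma unitary_fan_gates : all (unitary2 C) fan_gates.
Proof.
have nw j : `|w ^+ j| = 1 by rewrite normrX (norm_root_of_unity w1) expr1n.
apply: unitary_gset; apply/allP => a; rewrite 2!in_cons.
case/or3P=> [/eqP->|/eqP->|/mapP[j _ ->]]; rewrite ?normr1 ?nw //.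
by rewrite normfV normr_prod big1 ?invr1 // => j _.
Qed.

End FanoutPass.
End Passes.

(** * Kronecker products as one-qubit gates followed by a permutation *)

Section KroneckerLayers.
Variable C : numClosedFieldType.
Notation O := (dummy_family C).
Notation arity := (gate_arity C O).
Implicit Types (g : gate C) (gs : seq (gate C)) (x y : seq bool).

Definition width gs := sumn (map arity gs).
Definition gate_map g x : seq bool :=
  match g with
  | Tof m => tof_map m x | Mod q m => Defs.mod_map q m x | _ => x
  end.
Fixpoint kron_map gs x : seq bool :=
  if gs is g :: gs' then
    gate_map g (take (arity g) x) ++ kron_map gs' (drop (arity g) x) else [::].
Definition gate_units g : seq 'M[C]_2 :=
  if g is G1 U then [:: U] else nseq (arity g) 1%:M.
Definition kron_units gs := flatten (map gate_units gs).
Definition no_orc g := if g is Orc _ then false else true.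

(** The common form of Toffoli and MOD gates; it is an involution because [f] reads only the prefix,
    which is preserved. *)
Lemma toggle_last (f : seq bool -> bool) m x : size x = m.+1 ->
  let F x := take m x ++ [:: nth false x m (+) f (take m x)] in
  size (F x) = m.+1 /\ F (F x) = x.
Proof.
move=> sx F; have st : size (take m x) = m by rewrite size_takel ?sx.
split; first by rewrite size_cat st addn1.
rewrite /F take_size_cat // nth_cat st ltnn subnn /= -addbA addbb addbF.
by rewrite -[RHS](cat_take_drop m) (drop_nth false) ?sx // drop_oversize ?sx.
Qed.

Lemma gate_map_size g x : no_orc g -> size x = arity g -> size (gate_map g x) = arity g.
Proof.
case: g => //= [m|q m] _ sx; first by have [] := toggle_last (all id) sx.
by have [] := toggle_last (fun z => (count id z %% q != 0)%N) sx.
Qed.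

Lemma gate_mapK g x : no_orc g -> size x = arity g -> gate_map g (gate_map g x) = x.
Proof.
case: g => //= [m|q m] _ sx; first by have [] := toggle_last (all id) sx.
by have [] := toggle_last (fun z => (count id z %% q != 0)%N) sx.
Qed.

Lemma kron_map_size gs x : all no_orc gs -> size x = width gs ->
  size (kron_map gs x) = width gs.
Proof.
elim: gs x => //= g gs IH x /andP[og ogs] sx; rewrite size_cat gate_map_size //.
  by rewrite IH // size_drop sx addKn.
by rewrite size_takel // sx leq_addr.
Qed.

Lemma kron_mapK gs x : all no_orc gs -> size x = width gs ->
  kron_map gs (kron_map gs x) = x.
Proof.
elim: gs x => [|g gs IH] x /=; first by move=> _ /size0nil ->.
move=> /andP[og ogs] sx.
have st : size (take (arity g) x) = arity g by rewrite size_takel // sx leq_addr.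
rewrite take_size_cat ?drop_size_cat ?gate_map_size // gate_mapK // IH //.
  exact: cat_take_drop.
by rewrite size_drop sx addKn.
Qed.

Lemma kron_map_cat gs gs' x : kron_map (gs ++ gs') x =
  kron_map gs (take (width gs) x) ++ kron_map gs' (drop (width gs) x).
Proof.
elim: gs x => [|g gs IH] x /=; first by rewrite drop0.
rewrite IH -catA drop_drop take_takel ?leq_addr // take_drop.
by rewrite /width /= addnC.
Qed.

Lemma gate_units_size g : size (gate_units g) = arity g.
Proof. by case: g => //= *; rewrite size_nseq. Qed.

Definition mxprod (Us : seq 'M[C]_2) y x : C :=
  \prod_(p <- zip Us (zip y x)) p.1 (bidx p.2.1) (bidx p.2.2).

Lemma mxprod1 n y x : size y = n -> size x = n ->
  mxprod (nseq n 1%:M) y x = (y == x)%:R.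
Proof.
rewrite /mxprod; elim: n y x => [|n IH] [|b y] [|c x] //=; first by rewrite big_nil.
move=> [sy] [sx]; rewrite big_cons IH //= mxE bidx_eq eqseq_cons.
by case: eqP => _; rewrite ?mul1r ?mul0r.
Qed.

Lemma mxprod_cat U U' y y' x x' : size U = size y -> size y = size x ->
  mxprod (U ++ U') (y ++ y') (x ++ x') = mxprod U y x * mxprod U' y' x'.
Proof.
move=> sU sy; rewrite /mxprod !zip_cat ?big_cat //.
by rewrite size_zip -sy minnn.
Qed.

Lemma gate_semE g y x : no_orc g -> size y = arity g -> size x = arity g ->
  gate_sem C O g y x = mxprod (gate_units g) (gate_map g y) x.
Proof.
case: g => [U|m|q m|] //= _ sy sx.
- case: y x sy sx => [|b [|]] // [|c [|]] // _ _.
  by rewrite /mxprod /= big_cons big_nil mulr1.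
- rewrite -[X in mxprod X]/(nseq m.+1 1%:M) mxprod1 ?(gate_map_size (g := Tof C m)) //.
  have -> : (y == tof_map m x) = (tof_map m y == x).
    apply/eqP/eqP => [->|<-]; first exact: (gate_mapK (g := Tof C m)).
    by apply/esym; exact: (gate_mapK (g := Tof C m)).
  by case: eqP.
- rewrite -[X in mxprod X]/(nseq m.+1 1%:M) mxprod1 ?(gate_map_size (g := Mod C q m)) //.
  have -> : (y == Defs.mod_map q m x) = (Defs.mod_map q m y == x).
    apply/eqP/eqP => [->|<-]; first exact: (gate_mapK (g := Mod C q m)).
    by apply/esym; exact: (gate_mapK (g := Mod C q m)).
  by case: eqP.
Qed.

(* The one-qubit gates act first; the other gates are involutions, so that
   they may be moved to the output. *)
Lemma kron_semE gs y x : all no_orc gs -> size y = width gs -> size x = width gs ->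
  kron_sem C O gs y x = mxprod (kron_units gs) (kron_map gs y) x.
Proof.
elim: gs y x => [|g gs IH] y x /=; first by move=> _ _ /size0nil ->; rewrite /mxprod big_nil.
move=> /andP[og ogs] sy sx.
have st z : size z = (arity g + width gs)%N -> size (take (arity g) z) = arity g.
  by move=> sz; rewrite size_takel // sz leq_addr.
rewrite -[in RHS](cat_take_drop (arity g) x) /kron_units /= mxprod_cat; last 2 first.
- by rewrite gate_units_size gate_map_size ?st.
- by rewrite gate_map_size ?st.
by rewrite gate_semE ?st // IH // size_drop ?sy ?sx addKn.
Qed.

Lemma kron_sem_perm gs y x : all no_orc gs -> size y = width gs -> size x = width gs ->
  kron_units gs = nseq (width gs) 1%:M ->
  kron_sem C O gs y x = (y == kron_map gs x)%:R.
Proof.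
move=> og sy sx e; rewrite kron_semE // e mxprod1 ?kron_map_size //; congr (_%:R).
by congr nat_of_bool; apply/eqP/eqP => [<-|->]; rewrite kron_mapK.
Qed.

Lemma kron_units_size gs : size (kron_units gs) = width gs.
Proof.
by elim: gs => //= g gs IH; rewrite /kron_units /= size_cat -/(kron_units gs) IH gate_units_size.
Qed.

End KroneckerLayers.

(** * Reading the layers of a given circuit *)

Section LayersFromDefs.
Variables (C : numClosedFieldType) (N : nat).
Notation O := (dummy_family C).

(** Lines are plain numbers so that offsets can be added freely; [ord_gates] imposes the bound
    afterwards. *)
Definition ngate := (nat * seq nat * nat)%type.
Definition nlines (g : ngate) := rcons g.1.2 g.2.
Definition to_state (x : bits N) : state 'I_N := [ffun i => tnth x i].
Definition of_state (s : state 'I_N) : bits N := [tuple s i | i < N].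

Lemma to_stateK : cancel to_state of_state.
Proof. by move=> x; apply: eq_from_tnth => i; rewrite tnth_mktuple ffunE. Qed.

Lemma of_stateK : cancel of_state to_state.
Proof. by move=> s; apply/ffunP => i; rewrite ffunE tnth_mktuple. Qed.

Definition ord_lines (l : seq nat) : seq 'I_N := pmap insub l.
Definition ord_gates (gs : seq ngate) : seq (mgate 'I_N) :=
  pmap (fun g : ngate => omap (fun t => (g.1.1, ord_lines g.1.2, t)) (insub g.2)) gs.

Lemma val_ord_lines l : all (fun i => i < N)%N l -> map val (ord_lines l) = l.
Proof.
elim: l => //= i l IH /andP[iN /IH e]; rewrite /ord_lines /= insubT /=.
by rewrite -[in RHS]e.
Qed.

Definition nmap (gs : seq ngate) (x : seq bool) (i : nat) : bool :=
  nth false x i (+) \big[addb/false]_(g <- gs | g.2 == i)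
     fires g.1.1 (map (nth false x) g.1.2).

Lemma cmap_ord gs (x : bits N) i :
  all (fun i => i < N)%N (flatten (map nlines gs)) ->
  cmap (ord_gates gs) (to_state x) i = nmap gs x i.
Proof.
move=> aN; rewrite ffunE ffunE (tnth_nth false); congr (_ (+) _).
elim: gs aN => [|g gs IH] /=; first by rewrite !big_nil.
rewrite all_cat all_rcons => /andP[/andP[tN cN] /IH e].
rewrite /ord_gates /= insubT /= -/(ord_gates gs) !big_cons e -val_eqE /=.
case: ifP => // _; congr (_ (+) _); rewrite /gbit /=; congr fires.
rewrite -{2}(val_ord_lines cN) -map_comp; apply: eq_map => j.
by rewrite /= ffunE (tnth_nth false).
Qed.

Lemma strict_ord K gs : all (fun g : ngate => g.1.1 \in K) gs ->
  all (fun i => i < N)%N (flatten (map nlines gs)) ->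
  uniq (flatten (map nlines gs)) -> strict K (ord_gates gs).
Proof.
move=> aK aN uf; apply/andP; split.
  apply/allP => g; rewrite mem_pmap => /mapP[g' gi].
  by case: (insub _) => //= t [->] /=; apply: (allP aK).
rewrite -(map_inj_uniq val_inj) (_ : map _ _ = flatten (map nlines gs)) //.
elim: gs aN {aK uf} => //= g gs IH; rewrite all_cat all_rcons => /andP[/andP[tN cN] /IH e].
rewrite /ord_gates /= insubT /= -/(ord_gates gs) map_cat e; congr (_ ++ _).
by rewrite /lines /nlines map_rcons /= val_ord_lines.
Qed.

Definition cnot_gates (ps : seq (nat * nat)) : seq ngate :=
  [seq (0%N, [:: pr.1], pr.2) | pr <- ps].

Lemma cnot_gatesE ps (x : bits N) i : uniq (map snd ps) ->
  nmap (cnot_gates ps) x (i : 'I_N) = tnth (cnot_map N ps x) i.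
Proof.
move=> uq; rewrite tnth_mktuple /nmap (tnth_nth false) big_map.
elim: ps uq => [|pr ps IH] /=; first by rewrite big_nil addbF.
move=> /andP[nin uq]; rewrite big_cons /=; case: eqP => [e|_]; last exact: IH.
rewrite /= andbT big_seq_cond big1 ?addbF // => pr' /andP[pi /eqP e'].
by case/mapP: nin; exists pr' => //; rewrite e e'.
Qed.

Fixpoint kron_gates (o : nat) (gs : seq (gate C)) : seq ngate :=
  if gs is g :: gs' then
    let r := kron_gates (o + gate_arity C O g) gs' in
    match g with
    | Tof m => (0%N, iota o m, (o + m)%N) :: r
    | Mod q m => (q, iota o m, (o + m)%N) :: r
    | _ => r
    end
  else [::].

(** A subsequence of an interval is at once duplicate-free and bounded, the two conditions of
    [strict_ord] on lines. *)
Lemma kron_gates_sub o gs :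
  subseq (flatten (map nlines (kron_gates o gs))) (iota o (width gs)).
Proof.
have last_iota a m : rcons (iota a m) (a + m)%N = iota a m.+1.
  by rewrite -cats1 -[in RHS]addn1 iotaD.
elim: gs o => // g gs IH o.
rewrite -[width _]/(gate_arity C O g + width gs)%N iotaD.
pose A := match g with Tof m | Mod _ m => iota o m.+1 | _ => [::] end.
rewrite (_ : flatten _ = A ++ flatten (map nlines (kron_gates (o + gate_arity C O g) gs))).
  by apply: cat_subseq (IH _); rewrite /A; case: g {A} => *; rewrite ?sub0seq ?subseq_refl.
by rewrite /A; case: g {A} => //= [m|q m]; rewrite /nlines last_iota.
Qed.

Lemma kron_gates_tgt o gs g : g \in kron_gates o gs -> (o <= g.2)%N.
Proof.
move=> gi; have : g.2 \in iota o (width gs).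
  apply: (mem_subseq (kron_gates_sub o gs)); apply/flatten_mapP; exists g => //.
  by rewrite mem_rcons inE eqxx.
by rewrite mem_iota => /andP[].
Qed.

Lemma nmap_far o gs x i : (i < o)%N -> nmap (kron_gates o gs) x i = nth false x i.
Proof.
move=> io; rewrite /nmap big_seq_cond big1 ?addbF // => g /andP[/kron_gates_tgt og /eqP e].
by rewrite -e ltnNge og in io.
Qed.

End LayersFromDefs.

(** * Correctness of that reading *)

Section SimulateDefs.
Variables (C : numClosedFieldType) (N : nat).
Notation O := (dummy_family C).
Notation arity := (gate_arity C O).

Lemma kmul_invol (X : finType) (f : X -> X) (A : X -> X -> C) y x :
  involutive f -> kmul (kmap C f) A y x = A (f y) x.
Proof.
move=> fK; rewrite /kmul /kmap -[RHS](sum_delta (f y) (fun z => A z x)).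
apply: eq_bigr => z _; congr (_%:R * _); congr nat_of_bool.
by apply/eqP/eqP => ->; rewrite fK.
Qed.

Lemma sim_bij (X Y : finType) (i : X -> Y) (j : Y -> X) A B : cancel i j -> cancel j i ->
  (forall y x, B (i y) (i x) = A y x :> C) -> sim i i A B.
Proof.
move=> ij ji h x y; rewrite -{1}(ji y) h -(sum_delta (j y) (fun z => A z x)).
apply: eq_bigr => z _; congr (_%:R * _); congr nat_of_bool.
by apply/eqP/eqP => ->; rewrite ?ij ?ji.
Qed.

Lemma nth_toggle (f : seq bool -> bool) m (z : seq bool) i :
  size z = m.+1 -> (i <= m)%N ->
  nth false (take m z ++ [:: nth false z m (+) f (take m z)]) i =
  nth false z i (+) ((i == m) && f (take m z)).
Proof.
move=> sz im; rewrite nth_cat size_takel ?sz //; case: ltngtP im => //= [im _|-> _].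
  by rewrite nth_take // addbF.
by rewrite subnn.
Qed.

Lemma map_nth_iota_take (x : seq bool) o m : (o + m <= size x)%N ->
  map (nth false x) (iota o m) = take m (drop o x).
Proof.
move=> om; apply: (@eq_from_nth _ false).
  by rewrite size_map size_iota size_takel // size_drop leq_subRL ?(leq_trans (leq_addr _ _) om).
move=> i; rewrite size_map size_iota => im.
by rewrite (nth_map 0%N) ?size_iota // nth_iota // nth_take // nth_drop.
Qed.

Lemma nmap_cons (g : ngate) gs x j : nmap (g :: gs) x j =
  ((g.2 == j) && fires g.1.1 (map (nth false x) g.1.2)) (+) nmap gs x j.
Proof.
rewrite /nmap big_cons; case: eqP => _ //=.
by rewrite addbCA.
Qed.

(** [Mod 0] is excluded because kind 0 denotes the Toffoli gate. *)
Lemma kron_gatesE o gs (x : seq bool) i : all (@no_orc C) gs ->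
  all (fun g => if g is Mod 0 _ then false else true) gs ->
  size x = (o + width gs)%N -> (i < width gs)%N ->
  nth false (kron_map gs (drop o x)) i = nmap (kron_gates o gs) x (o + i).
Proof.
elim: gs o i => // g gs IH o i /andP[og ogs] /andP[qg qgs].
rewrite -[width _]/(arity g + width gs)%N => sx iw.
have st : size (take (arity g) (drop o x)) = arity g.
  by rewrite size_takel // size_drop sx addKn leq_addr.
rewrite -[kron_map _ _]/(gate_map g (take (arity g) (drop o x)) ++
  kron_map gs (drop (arity g) (drop o x))) nth_cat gate_map_size // drop_drop.
case: ltnP => ia.
  have nt : nth false (take (arity g) (drop o x)) i = nth false x (o + i).
    by rewrite nth_take // nth_drop.
  case: g og qg sx iw st ia nt => [U|m|q m|] //= _ qg sx iw st ia nt.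
  - by rewrite nt nmap_far // addn1 ltnS; case: i ia {iw nt} => //; rewrite addn0.
  - rewrite nmap_cons nmap_far ?ltn_add2l //= addbC nth_toggle // nt.
    rewrite eqn_add2l [m == i]eq_sym map_nth_iota_take ?take_takel //.
    by rewrite sx addnS ltnW // ltnS leq_add2l leq_addr.
  - rewrite nmap_cons nmap_far ?ltn_add2l //= addbC.
    rewrite (nth_toggle (fun z => count id z %% q != 0)%N) // nt.
    rewrite eqn_add2l [m == i]eq_sym map_nth_iota_take ?take_takel //; first by case: q qg.
    by rewrite sx addnS ltnW // ltnS leq_add2l leq_addr.
rewrite [(arity g + o)%N]addnC IH //; last 2 first.
- by rewrite sx addnA.
- by rewrite ltn_subLR.
rewrite -addnA subnKC //; case: g og qg sx iw st ia => [U|m|q m|] //= _ qg sx iw st ia.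
- by rewrite nmap_cons /= eqn_add2l (ltn_eqF ia).
- by rewrite nmap_cons /= eqn_add2l (ltn_eqF ia).
Qed.

Definition from_layer (L : layer C) : seq (mlayer C 'I_N) :=
  match L with
  | CNOTs ps => [:: Cl C (ord_gates N (cnot_gates ps))]
  | Kron gs => [:: One (fun i : 'I_N => nth 1%:M (kron_units gs) i);
                   Cl C (ord_gates N (kron_gates 0 gs))]
  end.

Lemma qacc_no_orc q S gs : all (qacc_gate C q S) gs -> all (@no_orc C) gs.
Proof. by apply: sub_all => -[]. Qed.

Lemma from_layer_ok q S L : wf_layer C O (qacc_gate C q S) N L ->
  all (lok (1%:M :: S) (strict [:: 0%N; q])) (from_layer L).
Proof.
case: L => [gs|ps] /= /andP[ok].
  move=> /eqP w; have sub := kron_gates_sub 0 gs; rewrite andbT; apply/andP; split.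
    have aU : all (fun U => U \in 1%:M :: S) (kron_units gs).
      apply: all_flatten_map ok => -[U /= US|m _|q' m _|//].
      - by rewrite inE US orbT.
      - by rewrite all_nseq inE eqxx orbT.
      - by rewrite all_nseq inE eqxx orbT.
    by apply/forallP => i; apply: (allP aU); rewrite mem_nth // kron_units_size /width w.
  apply: strict_ord.
  - have aK o : all (fun g : ngate => g.1.1 \in [:: 0%N; q]) (kron_gates o gs).
      elim: gs o ok {w sub} => //= g gs IH o /andP[ok oks].
      by case: g ok => //= [U _|m _|q' m /eqP ->]; rewrite ?inE ?eqxx ?orbT /= IH.
    exact: aK.
  - apply/allP => i /(mem_subseq sub); rewrite mem_iota add0n /width w.
    by case/andP.
  - exact: subseq_uniq sub (iota_uniq _ _).
move=> uf; rewrite andbT; have e : flatten (map nlines (cnot_gates ps)) =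
    flatten [seq [:: pr.1; pr.2] | pr <- ps] by rewrite -map_comp.
apply: strict_ord; rewrite ?e //; first by rewrite all_map; apply/allP.
apply/allP => i /flatten_mapP[pr pi]; have /and3P[h1 h2 _] := allP ok _ pi.
by rewrite !inE => /orP[] /eqP ->.
Qed.

Lemma cnot_uniq (ps : seq (nat * nat)) :
  uniq (flatten [seq [:: pr.1; pr.2] | pr <- ps]) -> uniq (map snd ps).
Proof.
elim: ps => //= pr ps IH /and3P[_ nin /IH ->]; rewrite andbT; apply: contra nin.
by case/mapP=> pr' pi ->; apply/flatten_mapP; exists pr' => //; rewrite !inE eqxx orbT.
Qed.

Lemma sim_from_layer q S L : (0 < q)%N -> wf_layer C O (qacc_gate C q S) N L ->
  sim (@to_state N) (@to_state N) (layer_sem C O N L) (csem (from_layer L)).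
Proof.
move=> q0 wf; apply: (sim_bij (@to_stateK N) (@of_stateK N)) => y x.
have := from_layer_ok wf; case: L wf => [gs|ps] /= /andP[ok].
  move=> /eqP w /and3P[_ st _]; have /andP[ow _] := strict_one_way st.
  rewrite kmul1l kmul_invol; last exact: cmapK.
  have og := qacc_no_orc ok.
  have qg : all (fun g : gate C => if g is Mod 0 _ then false else true) gs.
    by apply: sub_all ok => -[] //= q' m /eqP ->; case: (q) q0.
  rewrite kron_semE ?size_tuple ?[width gs]w // /one_sem /mxprod.
  have sk : size (kron_map gs y) = N by rewrite kron_map_size // size_tuple [width gs]w.
  have sz : size (zip (kron_units gs) (zip (kron_map gs y) x)) = N.
    by rewrite !size_zip kron_units_size sk size_tuple [width gs]w !minnn.
  rewrite (big_nth (1%:M, (false, false))) big_mkord sz; apply: eq_bigr => i _.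
  rewrite !nth_zip ?kron_units_size ?size_zip ?sk ?size_tuple ?minnn ?[width gs]w //=.
  rewrite [to_state x i]ffunE (tnth_nth false); congr (fun_of_matrix _ (bidx _) _).
  rewrite cmap_ord.
    by rewrite -(@kron_gatesE 0 gs y i) ?drop0 ?size_tuple ?[width gs]w.
  apply/allP => j /(mem_subseq (kron_gates_sub 0 gs)); rewrite mem_iota add0n [width gs]w.
  by case/andP.
move=> uf st; rewrite kmul1l /kmap.
have -> : cmap (ord_gates N (cnot_gates ps)) (to_state x) = to_state (cnot_map N ps x).
  apply/ffunP => i; rewrite cmap_ord; first by rewrite cnot_gatesE ?cnot_uniq // ffunE.
  rewrite -map_comp; apply/allP => j /flatten_mapP[pr pi].
  have /and3P[h1 h2 _] := allP ok _ pi.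
  by rewrite !inE => /orP[] /eqP ->.
by rewrite (inj_eq (can_inj (@to_stateK N))); case: eqP.
Qed.

End SimulateDefs.
Lemma val_to_bits N s : size s = N -> tval (to_bits N s) = s.
Proof.
move=> sN; apply: (@eq_from_nth _ false); rewrite ?size_tuple // => i iN.
by rewrite -[X in nth _ _ X]/(val (Ordinal iN)) -tnth_nth tnth_mktuple.
Qed.

(** * Writing layers on arbitrary lines as Kronecker products and CNOT layers *)

Section ToDefs.
Variables (C : numClosedFieldType) (T : finType) (q N' : nat) (ord0 : seq T).
Hypotheses (uniq0 : uniq ord0) (mem0 : forall t, t \in ord0).
Notation N := #|T|.
Hypothesis N'E : N' = (N + N)%N.
Notation O := (dummy_family C).
Implicit Types (a b s : state T) (gs : seq (mgate T)).

Lemma size_complete (r : seq T) : uniq r -> (forall t, t \in r) -> size r = N.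
Proof. by move=> ur mr; rewrite cardT; apply/eqP; rewrite -uniq_size_uniq ?enum_uniq // => t; rewrite mr mem_enum. Qed.

Section Moves.
Variable ord1 : seq T.
Hypotheses (uniq1 : uniq ord1) (mem1 : forall t, t \in ord1).

(** There are two copies of the lines: the first in a fixed order, the second in an order adapted to
    the layer at hand. *)
Definition enc a b : bits N' := to_bits N' (map a ord0 ++ map b ord1).
Definition pos0 t := index t ord0.
Definition pos1 t := (N + index t ord1)%N.

Lemma val_enc a b : tval (enc a b) = map a ord0 ++ map b ord1.
Proof. by rewrite val_to_bits // size_cat !size_map !size_complete. Qed.

Lemma pos0_lt t : (pos0 t < N)%N.
Proof. by rewrite -(size_complete uniq0 mem0) index_mem. Qed.

Lemma enc0 a b t : nth false (enc a b) (pos0 t) = a t.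
Proof.
rewrite val_enc nth_cat size_map size_complete // pos0_lt.
by rewrite (nth_map t) ?nth_index // index_mem.
Qed.

Lemma enc1 a b t : nth false (enc a b) (pos1 t) = b t.
Proof.
rewrite val_enc nth_cat size_map size_complete // ltnNge leq_addr /= addKn.
by rewrite (nth_map t) ?nth_index // index_mem.
Qed.

Lemma pos_cases i : (i < N')%N -> (exists t, i = pos0 t) \/ (exists t, i = pos1 t).
Proof.
rewrite N'E => iN; have [t0] : exists t : T, true.
  have : (0 < N)%N by case: N iN.
  by move/card_gt0P=> [t _]; exists t.
move=> _; case: (ltnP i N) => h.
  by left; exists (nth t0 ord0 i); rewrite /pos0 index_uniq // size_complete.
right; exists (nth t0 ord1 (i - N)); rewrite /pos1 index_uniq ?subnKC //.
by rewrite size_complete // ltn_subLR.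
Qed.

Lemma eq_enc (x : bits N') a b : (forall t, nth false x (pos0 t) = a t) ->
  (forall t, nth false x (pos1 t) = b t) -> x = enc a b.
Proof.
move=> h0 h1; apply/val_inj/(@eq_from_nth _ false); rewrite ?size_tuple // => i iN.
by have [[t ->]|[t ->]] := pos_cases iN; rewrite ?h0 ?h1 ?enc0 ?enc1.
Qed.

Lemma pos01 t t' : pos0 t <> pos1 t'.
Proof. by move=> e; have := pos0_lt t; rewrite e ltnNge leq_addr. Qed.

Lemma pos0_inj : injective pos0.
Proof. by move=> t t' /(congr1 (nth t ord0)); rewrite !nth_index. Qed.

Lemma pos1_inj : injective pos1.
Proof. by move=> t t' /addnI /(congr1 (nth t ord1)); rewrite !nth_index. Qed.

Definition move_pairs (src dst : T -> nat) := [seq (src t, dst t) | t <- enum T].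

Lemma cnot_move (src dst : T -> nat) (x : bits N') i : injective dst -> (i < N')%N ->
  nth false (cnot_map N' (move_pairs src dst) x) i =
  nth false x i (+) (if [pick t | dst t == i] is Some t then nth false x (src t) else false).
Proof.
move=> inj iN; rewrite -[X in nth _ _ X]/(val (Ordinal iN)) -tnth_nth tnth_mktuple !(tnth_nth false) /=.
rewrite /move_pairs filter_map -map_comp /=; case: pickP => [t /eqP e|no].
  rewrite (eq_filter (a2 := pred1 t)) ?filter_pred1_uniq ?enum_uniq ?mem_enum //.
  by move=> t' /=; rewrite -e (inj_eq inj).
by rewrite (eq_filter no) filter_pred0 /= addbF.
Qed.

Definition xors a b : state T := [ffun t => a t (+) b t].

Lemma pos0_ltN t : (pos0 t < N')%N.
Proof. by rewrite N'E (leq_trans (pos0_lt t)) ?leq_addr. Qed.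

Lemma pos1_ltN t : (pos1 t < N')%N.
Proof. by rewrite N'E ltn_add2l -(size_complete uniq1 mem1) index_mem. Qed.

Lemma cnot_out a b : cnot_map N' (move_pairs pos0 pos1) (enc a b) = enc a (xors b a).
Proof.
apply: eq_enc => t; rewrite cnot_move ?pos0_ltN ?pos1_ltN //; try exact: pos1_inj.
  case: pickP => [t' /eqP/esym/pos01 //|_]; by rewrite enc0 addbF.
case: pickP => [t' /eqP/pos1_inj -> |/(_ t)]; last by rewrite eqxx.
by rewrite enc0 enc1 ffunE.
Qed.

Lemma cnot_back a b : cnot_map N' (move_pairs pos1 pos0) (enc a b) = enc (xors a b) b.
Proof.
apply: eq_enc => t; rewrite cnot_move ?pos0_ltN ?pos1_ltN //; try exact: pos0_inj.
  case: pickP => [t' /eqP/pos0_inj -> |/(_ t)]; last by rewrite eqxx.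
  by rewrite enc0 enc1 ffunE.
case: pickP => [t' /eqP/pos01 //|_]; by rewrite enc1 addbF.
Qed.

Lemma wf_move (ok : pred (gate C)) (src dst : T -> nat) (lab : nat -> option T) :
  (forall t, (src t < N')%N) -> (forall t, (dst t < N')%N) ->
  (forall t, src t <> dst t) ->
  (forall t, lab (src t) = Some t) -> (forall t, lab (dst t) = Some t) ->
  wf_layer C O ok N' (CNOTs C (move_pairs src dst)).
Proof.
move=> s1 d1 ne ls ld; apply/andP; split.
  by rewrite all_map; apply/allP => t _ /=; rewrite s1 d1; apply/eqP.
rewrite -map_comp; apply: (@uniq_flatten_label _ _ _ _ Some lab).
- exact: enum_uniq.
- by move=> t t' _ _ [].
- by move=> t _ /=; rewrite inE andbT; apply/eqP.
- by move=> t l _ /=; rewrite !inE => /orP[] /eqP ->.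
Qed.

Definition pos_lab i : option T :=
  if (i < N)%N then nth None (map Some ord0) i else nth None (map Some ord1) (i - N).

Lemma pos_lab0 t : pos_lab (pos0 t) = Some t.
Proof. by rewrite /pos_lab pos0_lt (nth_map t) ?nth_index ?index_mem. Qed.

Lemma pos_lab1 t : pos_lab (pos1 t) = Some t.
Proof. by rewrite /pos_lab ltnNge leq_addr /= addKn (nth_map t) ?nth_index ?index_mem. Qed.

End Moves.

Definition zero : state T := [ffun=> false].
Definition park s : bits N' := to_bits N' (map s ord0 ++ nseq N false).

Lemma map_zero (r : seq T) : map zero r = nseq (size r) false.
Proof. by elim: r => //= t r ->; rewrite ffunE. Qed.

Lemma parkE ord1 s : uniq ord1 -> (forall t, t \in ord1) -> park s = enc ord1 s zero.
Proof. by move=> u1 m1; rewrite /park /enc map_zero (size_complete u1 m1). Qed.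

(** Controls and target of each gate become consecutive, as a Kronecker product demands. *)
Definition gate_order gs :=
  flatten (map (@lines T) gs) ++
  [seq t <- enum T | t \notin flatten (map (@lines T) gs)].
(** A Kronecker layer must cover all lines, so the identity has to be an allowed gate. *)
Definition idle n := nseq n (G1 C 1%:M).
Definition def_gate (g : mgate T) : gate C :=
  if g.1.1 is 0 then Tof C (size g.1.2) else Mod C g.1.1 (size g.1.2).
Definition kron_of gs :=
  idle N ++ map def_gate gs ++
  idle (size [seq t <- enum T | t \notin flatten (map (@lines T) gs)]).

(** With s' for the result, the two copies pass through (s, 0), (s, s), (0, s), (0, s'), (s', s'),
    (s', 0). A move takes two CNOT layers, one to copy and one to erase. *)
Definition to_layers (L : mlayer C T) : seq (layer C) :=
  match L with
  | One U => [:: Kron C ([seq G1 C (U t) | t <- ord0] ++ idle N)]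
  | Cl gs =>
    let out := CNOTs C (move_pairs pos0 (pos1 (gate_order gs))) in
    let back := CNOTs C (move_pairs (pos1 (gate_order gs)) pos0) in
    [:: out; back; Kron C (kron_of gs); back; out]
  end.

Lemma width_cat (g1 g2 : seq (gate C)) : width (g1 ++ g2) = (width g1 + width g2)%N.
Proof. by rewrite /width map_cat sumn_cat. Qed.

Lemma width_idle n : width (idle n) = n.
Proof. by elim: n => // n IH; rewrite /width /= -[sumn _]/(width (idle n)) IH. Qed.

Lemma width_def gs : width (map def_gate gs) = size (flatten (map (@lines T) gs)).
Proof.
elim: gs => //= g gs IH; rewrite size_cat -IH size_rcons /width /=.
by rewrite /def_gate; case: g.1.1.
Qed.

Lemma kron_map_idle n x : size x = n -> kron_map (idle n) x = x.
Proof. by elim: n x => [|n IH] [|b x] //= [sx]; rewrite take0 drop0 IH. Qed.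

Lemma kron_units_cat (g1 g2 : seq (gate C)) :
  kron_units (g1 ++ g2) = kron_units g1 ++ kron_units g2.
Proof. by rewrite /kron_units map_cat flatten_cat. Qed.

Lemma kron_units_idle n : kron_units (idle n) = nseq n 1%:M.
Proof. by elim: n => // n IH; rewrite /kron_units /= -/(kron_units _) IH. Qed.

Lemma kron_units_def gs :
  kron_units (map def_gate gs) = nseq (width (map def_gate gs)) 1%:M.
Proof.
elim: gs => //= g gs IH; rewrite /kron_units /= -/(kron_units _) IH.
rewrite /width /= -/(width _) nseqD; congr (_ ++ _).
by rewrite /def_gate; case: g.1.1.
Qed.

Section StrictLayer.
Variable gs : seq (mgate T).
Hypothesis st : strict [:: 0%N; q] gs.

Lemma gate_order_uniq : uniq (gate_order gs).
Proof.
have /andP[_ uf] := st; rewrite cat_uniq uf filter_uniq ?enum_uniq //= andbT.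
by apply/hasPn => t; rewrite mem_filter => /andP[].
Qed.

Lemma gate_order_mem t : t \in gate_order gs.
Proof. by rewrite mem_cat mem_filter mem_enum andbT; case: (_ \in _). Qed.

Lemma width_kron_of : width (kron_of gs) = N'.
Proof.
rewrite /kron_of !width_cat !width_idle width_def -size_cat N'E.
by rewrite -/(gate_order gs) (size_complete gate_order_uniq gate_order_mem).
Qed.

Lemma no_orc_kron_of : all (@no_orc C) (kron_of gs).
Proof.
rewrite !all_cat !all_nseq !orbT /= andbT all_map.
by apply/allP => g _; rewrite /= /def_gate; case: g.1.1.
Qed.

Lemma kron_map_def s :
  kron_map (map def_gate gs) (map s (flatten (map (@lines T) gs))) =
  map (cmap gs s) (flatten (map (@lines T) gs)).
Proof.
have /andP[ow uq] := strict_one_way st.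
have same g t : g \in gs -> t \in g.1.2 -> cmap gs s t = s t.
  move=> gi tg; apply: cmap_notin; apply/mapP => -[g' gi' e].
  by move/allP: ow => /(_ _ gi') /allP/(_ _ gi); rewrite -e tg.
have tgt g : g \in gs -> cmap gs s g.2 = s g.2 (+) gbit s g by apply: cmap_in.
suff main gs' : {subset gs' <= gs} ->
    kron_map (map def_gate gs') (map s (flatten (map (@lines T) gs'))) =
    map (cmap gs s) (flatten (map (@lines T) gs')) by exact: main.
elim: gs' => // g gs' IH sub; have gi : g \in gs by apply: sub; rewrite inE eqxx.
have ar : gate_arity C O (def_gate g) = size (map s (lines g)).
  by rewrite size_map size_rcons /def_gate; case: g.1.1.
rewrite /= !map_cat take_size_cat // drop_size_cat // IH => [|g' g'i]; last first.
  by apply: sub; rewrite inE g'i orbT.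
congr (_ ++ _); rewrite /lines !map_rcons tgt //.
have -> : map (cmap gs s) g.1.2 = map s g.1.2.
  by apply/eq_in_map => t; apply: same.
rewrite /def_gate /gbit; set cs := map s g.1.2.
have sc : size cs = size g.1.2 by rewrite size_map.
by case: g.1.1 => [|k]; rewrite /= /tof_map /Defs.mod_map -cats1 -sc
  take_size_cat // nth_cat ltnn subnn /= cats1.
Qed.

Lemma kron_map_of s :
  kron_map (kron_of gs) (enc (gate_order gs) zero s) = enc (gate_order gs) zero (cmap gs s).
Proof.
have ou := gate_order_uniq; have om := gate_order_mem.
rewrite !val_enc // !map_zero /kron_of kron_map_cat width_idle.
have s0 := size_complete uniq0 mem0.
rewrite take_size_cat ?drop_size_cat ?size_nseq ?s0 // kron_map_idle ?size_nseq //.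
congr (_ ++ _); rewrite /gate_order !map_cat kron_map_cat width_def.
rewrite take_size_cat ?drop_size_cat ?size_map // kron_map_def; congr (_ ++ _).
rewrite kron_map_idle ?size_map //; apply/eq_in_map => t; rewrite mem_filter => /andP[nt _].
rewrite cmap_notin //; apply: contra nt => /mapP[g gi ->]; apply/flatten_mapP.
by exists g => //; rewrite mem_rcons inE eqxx.
Qed.

Lemma kron_units_of : kron_units (kron_of gs) = nseq (width (kron_of gs)) 1%:M.
Proof.
rewrite /kron_of !kron_units_cat !width_cat !kron_units_idle kron_units_def !width_idle.
by rewrite !nseqD.
Qed.

End StrictLayer.

Lemma circ_sem_cat n (L1 L2 : seq (layer C)) :
  circ_sem C O n (L1 ++ L2) = kmul (circ_sem C O n L2) (circ_sem C O n L1).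
Proof.
elim: L1 => [|L L1 IH] /=.
  apply: functional_extensionality => y; apply: functional_extensionality => x.
  rewrite /kmul -[LHS](sum_deltar x); apply: eq_bigr => z _.
  by rewrite /opid; case: eqP.
by rewrite IH -[opmul _ _ _ _]/(kmul _ _) -kmulA.
Qed.

Lemma circ_sem1 n (L : layer C) : circ_sem C O n [:: L] = layer_sem C O n L.
Proof.
apply: functional_extensionality => y; apply: functional_extensionality => x.
rewrite /= /opmul -[RHS](sum_delta y (fun z => layer_sem C O n L z x)).
by apply: eq_bigr => z _; rewrite /opid eq_sym; case: eqP.
Qed.

Lemma layer_sem_cnots n ps : layer_sem C O n (CNOTs C ps) = kmap C (cnot_map n ps).
Proof.
apply: functional_extensionality => y; apply: functional_extensionality => x.
by rewrite /= /kmap; case: eqP.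
Qed.

Lemma sim_to_layers_Cl gs : strict [:: 0%N; q] gs ->
  sim park park (kmap C (cmap gs)) (circ_sem C O N' (to_layers (Cl C gs))).
Proof.
move=> st; have ou := gate_order_uniq st; have om t : t \in gate_order gs by exact: gate_order_mem.
rewrite /to_layers -cat1s circ_sem_cat -cat1s circ_sem_cat -cat1s circ_sem_cat.
rewrite -[[:: CNOTs _ _; _]]cat1s circ_sem_cat !circ_sem1 !layer_sem_cnots.
have xx s : xors s s = zero by apply/ffunP => t; rewrite !ffunE addbb.
have x0 s : xors s zero = s by apply/ffunP => t; rewrite !ffunE addbF.
have x0l s : xors zero s = s by apply/ffunP => t; rewrite !ffunE.
pose par s := enc (gate_order gs) s zero.
pose both s := enc (gate_order gs) s s.
pose moved s := enc (gate_order gs) zero s.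
have pE : park = par by apply: functional_extensionality => s; apply: parkE.
(* The map is padded with four identities, so that each of the five layers simulates one factor. *)
rewrite pE -[kmap C (cmap gs)]kmul1l -{1}[kmap C id]kmul1.
rewrite -[X in kmul _ X](kmul1 (kmap C (cmap gs))) -[X in kmul _ (kmul _ X)](kmul1 (kmap C id)).
rewrite !kmulA.
apply: (sim_mul (j := both)); last first.
  by apply: sim_map => s; rewrite cnot_out // x0l.
apply: (sim_mul (j := moved)); last first.
  by apply: sim_map => s; rewrite cnot_back // xx.
apply: (sim_mul (j := moved)); last first.
  move=> s y; rewrite /= kron_sem_perm ?size_tuple ?card_ord ?width_kron_of ?no_orc_kron_of //.
    by rewrite sum_deltar kron_map_of // -val_eqE.
  by rewrite kron_units_of width_kron_of.
apply: (sim_mul (j := both)).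
  by apply: sim_map => s; rewrite cnot_out // xx.
by apply: sim_map => s; rewrite cnot_back // x0l.
Qed.

Lemma val_park s : tval (park s) = map s ord0 ++ nseq N false.
Proof. by rewrite val_to_bits // size_cat size_map size_nseq (size_complete uniq0 mem0). Qed.

Lemma park_inj : injective park.
Proof.
move=> s s' e; apply/ffunP => t.
by rewrite -(enc0 uniq0 mem0 s zero t) -(enc0 uniq0 mem0 s' zero t) -!parkE // e.
Qed.

Lemma kron_map_G1 (Us : seq 'M[C]_2) x : size x = size Us -> kron_map (map (@G1 C) Us) x = x.
Proof. by elim: Us x => [|U Us IH] [|b x] //= [sx]; rewrite take0 drop0 IH. Qed.

Lemma kron_units_G1 (Us : seq 'M[C]_2) : kron_units (map (@G1 C) Us) = Us.
Proof. by elim: Us => // U Us IH; rewrite /kron_units /= -/(kron_units _) IH. Qed.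

Lemma width_G1 (Us : seq 'M[C]_2) : width (map (@G1 C) Us) = size Us.
Proof. by elim: Us => // U Us IH; rewrite /width /= -/(width _) IH. Qed.

Lemma mxprod_map U s s' :
  mxprod (map U ord0) (map s' ord0) (map s ord0) = one_sem U s' s :> C.
Proof.
rewrite /mxprod (_ : zip _ _ = [seq (U t, (s' t, s t)) | t <- ord0]); last first.
  by elim: (ord0) => //= t r ->.
by rewrite big_map big_uniq //; apply: eq_bigl => t; rewrite mem0.
Qed.

Lemma sim_to_layers_One U :
  sim park park (one_sem U) (circ_sem C O N' (to_layers (One U))).
Proof.
have s0 := size_complete uniq0 mem0.
rewrite /to_layers circ_sem1 => s y /=.
have -> : [seq G1 C (U t) | t <- ord0] ++ idle N =
    map (@G1 C) (map U ord0 ++ nseq N 1%:M) by rewrite map_cat -map_comp map_nseq.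
have sU : size (map U ord0 ++ nseq N 1%:M) = N'.
  by rewrite size_cat size_map size_nseq s0 N'E.
rewrite kron_semE; last 3 first.
- by rewrite all_map; apply/allP.
- by rewrite size_tuple width_G1.
- by rewrite size_tuple ?card_ord width_G1 sU.
rewrite kron_units_G1 kron_map_G1 ?sU ?size_tuple //.
(* The first half of the output; the output is the parked [sy] exactly when its second half is
   zero. *)
pose sy : state T := [ffun t => nth false y (pos0 t)].
have y1 : take N y = map sy ord0.
  have stk : size (take N y) = N by rewrite size_takel // size_tuple N'E leq_addr.
  apply: (@eq_from_nth _ false) => [|i]; rewrite stk ?size_map ?s0 // => iN.
  have [t0 _] : exists t : T, true.
    by have /card_gt0P[t _] : (0 < N)%N by [apply: leq_ltn_trans iN]; exists t.
  rewrite nth_take // (nth_map t0) ?s0 // ffunE /pos0 index_uniq ?s0 //.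
rewrite -[tval y in LHS](cat_take_drop N) val_park mxprod_cat; last 2 first.
- by rewrite y1 !size_map.
- by rewrite y1 !size_map.
rewrite y1 mxprod_map mxprod1 ?size_nseq ?size_drop ?size_tuple ?N'E ?addKn //.
case: eqP => [y2|ne].
  have -> : y = park sy by apply/val_inj; rewrite /= val_park -y1 -y2 cat_take_drop.
  under eq_bigr => z _ do rewrite (inj_eq park_inj) eq_sym.
  by rewrite sum_delta mulr1.
rewrite mulr0 big1 // => s' _; case: eqP => [e|]; rewrite ?mul0r //.
by case: ne; rewrite e val_park drop_size_cat // size_map s0.
Qed.

Lemma sim_to_layers S L : lok S (strict [:: 0%N; q]) L ->
  sim park park (lsem L) (circ_sem C O N' (to_layers L)).
Proof.
by case: L => [U _|gs st]; [apply: sim_to_layers_One|apply: sim_to_layers_Cl].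
Qed.

Lemma to_layers_ok S L : 1%:M \in S -> lok S (strict [:: 0%N; q]) L ->
  all (wf_layer C O (qacc_gate C q S) N') (to_layers L).
Proof.
have s0 := size_complete uniq0 mem0.
move=> S1; case: L => [U /forallP US|gs st].
  rewrite /to_layers all_seq1; apply/andP; split.
    rewrite all_cat all_nseq /= S1 orbT andbT all_map.
    by apply/allP => t _ /=; apply: US.
  rewrite -[sumn _]/(width _) width_cat width_idle (_ : map _ _ = map (@G1 C) (map U ord0)).
    by rewrite width_G1 size_map s0 N'E.
  by rewrite -map_comp.
have ou := gate_order_uniq st; have om t : t \in gate_order gs by exact: gate_order_mem.
have w1 ok : wf_layer C O ok N' (CNOTs C (move_pairs pos0 (pos1 (gate_order gs)))).
  apply: (@wf_move _ _ _ (pos_lab (gate_order gs))) => t.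
  - exact: pos0_ltN.
  - exact: pos1_ltN.
  - exact: pos01.
  - exact: pos_lab0.
  - exact: pos_lab1.
have w2 ok : wf_layer C O ok N' (CNOTs C (move_pairs (pos1 (gate_order gs)) pos0)).
  apply: (@wf_move _ _ _ (pos_lab (gate_order gs))) => t.
  - exact: pos1_ltN.
  - exact: pos0_ltN.
  - by move=> e; apply: (@pos01 (gate_order gs) t t).
  - exact: pos_lab1.
  - exact: pos_lab0.
have w3 : wf_layer C O (qacc_gate C q S) N' (Kron C (kron_of gs)).
  apply/andP; split; last by rewrite -[sumn _]/(width _) width_kron_of.
  rewrite !all_cat !all_nseq /= S1 !orbT andbT /= all_map.
  apply/allP => g gi; have /andP[/allP/(_ _ gi) + _] := st.
  by rewrite /= /def_gate; case: g.1.1 => //= k; rewrite !inE.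
apply/and5P; split; [exact: w1|exact: w2|exact: w3|exact: w2|].
by apply/andP; split; [exact: w1|].
Qed.

Lemma size_to_layers L : (size (to_layers L) <= 5)%N.
Proof. by case: L. Qed.

End ToDefs.

(** * Assembly of the translations *)

Section Assembly.
Variables (C : numClosedFieldType) (m m' : nat) (w w' : C).
Hypotheses (wP : m.+1.-primitive_root w) (wn1 : w != 1).
Hypothesis w'P : m'.+1.-primitive_root w'.
Notation O := (dummy_family C).

Section Lines.
Variable N0 : nat.
Definition all_lines : finType := ext (ext 'I_N0 m') m.
Definition data (i : 'I_N0) : all_lines := ((i, None), None).
(** The original lines come first, so the embedding appends zeros, which matches the form
    [cat_tuple x z] in the definition of reducibility. *)
Definition line_order : seq all_lines :=
  map data (enum 'I_N0) ++ [seq t <- enum all_lines | t \notin map data (enum 'I_N0)].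

Lemma data_inj : injective data. Proof. by move=> i j []. Qed.

Lemma line_order_uniq : uniq line_order.
Proof.
rewrite cat_uniq; apply/and3P; split.
- by rewrite (map_inj_uniq data_inj) enum_uniq.
- by apply/hasPn => t; rewrite mem_filter => /andP[].
- by rewrite filter_uniq ?enum_uniq.
Qed.

Lemma line_order_mem t : t \in line_order.
Proof. by rewrite mem_cat mem_filter mem_enum andbT; case: (_ \in _). Qed.

(** One factor for each extension: eight slots of work lines and the line itself. *)
Definition line_count := (((8 * m'.+1).+1) * (8 * m.+1).+1)%N.

Lemma card_all_lines : #|all_lines| = (N0 * line_count)%N.
Proof.
rewrite !card_prod !card_option !card_prod !card_bool !card_ord -mulnA.
by [].
Qed.

Definition simulation (Ls : seq (layer C)) : seq (layer C) :=
  flatten (map (to_layers line_order)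
   (flatten (map (@fan_pass C m w _)
     (flatten (map (@mod_pass C m' w' _)
        (flatten (map (@from_layer C N0) Ls))))))).

Variable S : seq 'M[C]_2.
Definition sim_gates := fan_gates m w ++ mod_gates m' w' ++ 1%:M :: S.

Variables (N' : nat) (Ls : seq (layer C)).
Hypothesis N'E : N' = (#|all_lines| + #|all_lines|)%N.
Hypothesis wfL : all (wf_layer C O (qacc_gate C m'.+1 S) N0) Ls.

Definition embedding (x : bits N0) : bits N' :=
  park N' line_order (emb m (emb m' (to_state x))).

Let ok1 := all_flatten_map (fun L => from_layer_ok (q := m'.+1) (S := S) (L := L)) wfL.
Let ok2 := all_flatten_map (fun L => @mod_pass_ok C m' w' _ (1%:M :: S) L) ok1.
Let ok3 := all_flatten_map (fun L => @fan_pass_ok C m w _ _ L) ok2.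

Lemma simulation_ok : all (wf_layer C O (qacc_gate C m.+1 sim_gates) N') (simulation Ls).
Proof.
apply: all_flatten_map ok3 => L okL; apply: to_layers_ok => //.
- exact: line_order_uniq.
- exact: line_order_mem.
- by rewrite mem_cat mem_head.
Qed.

Lemma sim_simulation :
  sim embedding embedding (circ_sem C O N0 Ls) (circ_sem C O N' (simulation Ls)).
Proof.
have s1 : sim (@to_state N0) (@to_state N0) (circ_sem C O N0 Ls)
    (csem (flatten (map (@from_layer C N0) Ls))).
  elim: Ls wfL => [_ x y|L Ls' IH /= /andP[wf wfs]] /=.
    rewrite /kmap -[LHS](sum_deltar x (fun z => (y == to_state z)%:R)).
    by apply: eq_bigr => z _; rewrite /opid; case: (z == x).
  rewrite csem_cat; apply: sim_mul (IH wfs) _.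
  exact: (sim_from_layer (q := m'.+1) (S := S)).
have s2 := sim_circuit (fun L => sim_mod_pass w'P (L := L)) ok1.
have s3 := sim_circuit (fun L => sim_fan_pass (prim_expr_order wP) wn1 (L := L)) ok2.
suff s4 : forall Ms, all (lok sim_gates (strict [:: 0%N; m.+1])) Ms ->
    sim (park N' line_order) (park N' line_order) (csem Ms)
      (circ_sem C O N' (flatten (map (to_layers line_order) Ms))).
  exact: sim_comp (sim_comp (sim_comp s1 s2) s3) (s4 _ ok3).
elim=> [_|L Ms IH /= /andP[okL okM]] /=.
  move=> s y; rewrite /kmap sum_deltar /opid; case: eqP => //.
rewrite circ_sem_cat; apply: sim_mul (IH okM) _.
apply: sim_to_layers okL => //; [exact: line_order_uniq|exact: line_order_mem].
Qed.

Lemma embeddingE x : tval (embedding x) = x ++ nseq (N' - N0) false.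
Proof.
rewrite val_park //; [|exact: line_order_uniq|exact: line_order_mem].
rewrite map_cat -map_comp -catA; congr (_ ++ _).
  rewrite -[RHS]map_tnth_enum; apply: eq_map => i /=.
  by rewrite !ffunE.
set r := filter _ _; have sr : (N0 + size r = #|all_lines|)%N.
  rewrite -(size_complete line_order_uniq line_order_mem) size_cat size_map.
  by rewrite size_enum_ord.
rewrite (_ : map _ r = nseq (size r) false).
  by rewrite -nseqD N'E -sr -addnA addKn sr.
have : all (fun t => t \notin map data (enum 'I_N0)) r by apply: filter_all.
elim: r {sr} => //= -[[i [v|]] [u|]] r IH /andP[nt /IH ->]; rewrite !ffunE //=.
by case/mapP: nt; exists i; rewrite ?mem_enum.
Qed.

Lemma embedding_inj : injective embedding.
Proof.
move=> x x' /(congr1 (take N0 \o @tval _ _)) /=; rewrite -!/(tval (embedding _)) !embeddingE.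
by rewrite !take_size_cat ?size_tuple // => /val_inj.
Qed.

Lemma circ_sem_embedding y x :
  circ_sem C O N' (simulation Ls) (embedding y) (embedding x) = circ_sem C O N0 Ls y x.
Proof. exact: (sim_inj embedding_inj sim_simulation). Qed.

(** From left to right, the expansion of one layer by [to_layers], [fan_pass], [mod_pass] and
    [from_layer]. *)
Definition sim_depth := (5 * ((4 * (4 * m.+1) + 8) * ((4 * (3 * m'.+1) + 9) * 2)))%N.

Lemma size_simulation : (size (simulation Ls) <= sim_depth * size Ls)%N.
Proof.
apply: leq_trans (size_flatten_le _ (size_to_layers line_order)) _.
rewrite -!mulnA leq_mul2l /=.
apply: leq_trans (size_flatten_le _ (@size_fan_pass C m w _)) _; rewrite leq_mul2l.
apply/orP; right; apply: leq_trans (size_flatten_le _ (@size_mod_pass C m' w' _)) _.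
rewrite leq_mul2l; apply/orP; right; apply: size_flatten_le.
by case.
Qed.

End Lines.

Lemma unitary_sim_gates S : all (unitary2 C) S -> all (unitary2 C) (sim_gates S).
Proof.
move=> uS; rewrite /sim_gates !all_cat (unitary_fan_gates (prim_expr_order wP)).
by rewrite (unitary_mod_gates w'P) /= unitary2_1.
Qed.

End Assembly.

(** ['X^n - 1] is separable in characteristic 0, so it has [n] distinct roots, and these include a
    primitive one. *)
Lemma exists_prim_root (C : numClosedFieldType) n : (0 < n)%N ->
  exists w : C, n.-primitive_root w.
Proof.
move=> n0; pose p : {poly C} := 'X^n - 1; have [r Dp] := closed_field_poly_normal p.
move: Dp; rewrite (monicP _) ?monicXnsubC // scale1r => Dp.
have rn1 : all (root p) r by apply/allP=> z; rewrite Dp root_prod_XsubC.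
have sz_r : (n < (size r).+1)%N.
  by rewrite -(size_prod_XsubC r id) -Dp size_XnsubC.
have [|z _ zP] := hasP (has_prim_root n0 rn1 _ sz_r); last by exists z.
by rewrite -separable_prod_XsubC -Dp separable_Xn_sub_1 // pnatr_eq0 -lt0n.
Qed.

Lemma poly_bounded_linear (p p' : nat -> nat) K :
  poly_bounded p -> (forall n, p' n <= K * (n + p n))%N -> poly_bounded p'.
Proof.
(* The exponent is raised so that the power also dominates the summand [n]; one [c] in the constant
   pays for [n ^ k] at [n = 0], [k = 0]. *)
move=> [c [k h]] h'; exists (K * (1 + c + c))%N, k.+1 => n.
apply: leq_trans (h' n) _; rewrite -mulnA -mulnDr leq_mul2l; apply/orP; right.
have nk : (n <= n ^ k.+1)%N.
  by case: n => [|n] //; rewrite expnS leq_pmulr // expn_gt0.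
have nk' : (n ^ k <= n ^ k.+1 + 1)%N.
  case: n {h h' nk} => [|n]; first by case: k => [|k] //; rewrite exp0n.
  by rewrite (leq_trans _ (leq_addr _ _)) // leq_pexp2l.
have := leq_trans (h n) (leq_add (leq_mul (leqnn c) nk') (leqnn c)).
rewrite mulnDr muln1 => h2; apply: leq_trans (leq_add nk h2) _.
rewrite !mulnDl !mul1n -!addnA leq_add2l leq_add2l.
by rewrite [(1 + _)%N]addnC; lia.
Qed.

(** [G] is the compiled circuit itself, so that the reduction is a single oracle call. *)
Lemma QACCq_reduction (C : numClosedFieldType) (q q' : nat) (F : qfamily C) :
  (2 <= q)%N -> (2 <= q')%N -> QACCq C q' F ->
  exists G : qfamily C, QACCq C q G /\ qac0_reducible C F G.
Proof.
case: q q' => [|m] [|m'] // m1 m1' [polyF [d [S [Cn [uS cF]]]]].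
have [w wP] := exists_prim_root C (ltn0Sn m).
have [w' w'P] := exists_prim_root C (ltn0Sn m').
have wn1 : w != 1.
  rewrite -[w]expr1 -(prim_order_dvd wP); apply: contraL m1 => /dvdn_leq -/(_ isT).
  by rewrite -ltnNge.
(* All lines of [F], its own work lines included, are data for the simulation. The factor [K] is
   doubled for the second copy used by [to_layers]. *)
pose N0 n := (n + fam_p C F n)%N; pose K := (line_count m m' + line_count m m')%N.
have K0 : (1 <= K)%N by rewrite /K /line_count addn_gt0 muln_gt0.
(* Chosen to make the total number of lines [N0 n * K]; [K0] prevents truncation. *)
pose pG n := (N0 n * K - n)%N.
have nG n : (n + pG n)%N = (N0 n * K)%N.
  by rewrite subnKC // (leq_trans (leq_addr _ _ : n <= N0 n)%N) // leq_pmulr.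
have cardE n : (n + pG n)%N = (#|all_lines m m' (N0 n)| + #|all_lines m m' (N0 n)|)%N.
  by rewrite nG !card_all_lines mulnDr.
pose G := Family C pG
  (fun n => circ_sem C (dummy_family C) (n + pG n) (simulation m m' w w' (N0 n) (Cn n))).
have polyG : poly_bounded pG.
  by apply: (poly_bounded_linear (K := K) polyF) => n; rewrite mulnC leq_subr.
exists G; split.
  split=> //; exists (sim_depth m m' * d)%N, (sim_gates m m' w w' S).
  exists (fun n => simulation m m' w w' (N0 n) (Cn n)).
  split=> [|n]; first exact: unitary_sim_gates.
  have [sz [wf _]] := cF n; split; last split=> //.
    by apply: leq_trans (size_simulation _ _ _ _ _ _) _; rewrite leq_mul2l sz orbT.
  exact: simulation_ok.
(* One layer with one oracle gate and no one-qubit gates; the remaining lines of [G] are the work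
   bits, all set to zero below. *)
exists (fun n => pG n - fam_p C F n)%N, 1%N, [::], (fun n => [:: Kron C [:: Orc C n]]).
have pp n : (fam_p C F n + (pG n - fam_p C F n))%N = pG n.
  by rewrite subnKC // -(leq_add2l n) nG leq_pmulr.
split; last split=> // n.
  by apply: (poly_bounded_linear (K := K) polyF) => n; rewrite pp mulnC leq_subr.
have [sz [wf semF]] := cF n; split=> //; split.
  rewrite /= andbT; apply/eqP.
  by rewrite addn0 -[RHS]/(n + fam_p C F n + (pG n - fam_p C F n))%N -addnA pp.
move=> y x; exists [tuple of nseq _ false].
rewrite semF -(circ_sem_embedding wP wn1 w'P (cardE n) wf).
rewrite /= /opmul (bigD1 (cat_tuple y [tuple of nseq _ false])) //= big1 ?addr0; last first.
  by move=> z /negbTE nz; rewrite /opid eq_sym nz mul0r.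
rewrite /opid eqxx mul1r mulr1.
(* The line numbers of [G] and of the reduction are equal but not convertible, so the bit strings
   are compared as sequences. *)
have take_id (v : bits (N0 n)) :
  embedding m m' (n + pG n) v =
  to_bits (n + pG n) (take (n + pG n) (v ++ nseq (pG n - fam_p C F n) false)).
  apply/val_inj; rewrite -[RHS]/(tval (to_bits _ _)) val_to_bits.
    rewrite -[LHS]/(tval (embedding _ _ _ _)) embeddingE // take_oversize; first by rewrite /N0 subnDl.
    by rewrite size_cat size_tuple size_nseq /N0 -addnA pp.
  by rewrite size_takel // size_cat size_tuple size_nseq /N0 -addnA pp.
by rewrite !take_id.
Qed.

Theorem mainTheorem7 (R : realType) (q : nat) : (2 <= q)%N ->
  (forall F : qfamily (complex R), QACC (complex R) F ->
     exists G : qfamily (complex R),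
       QACCq (complex R) q G /\ qac0_reducible (complex R) F G) /\
  (forall G : qfamily (complex R), QACCq (complex R) q G ->
     exists F : qfamily (complex R),
       QACC (complex R) F /\ qac0_reducible (complex R) G F).
Proof.
move=> q2; split=> [F [q' [q'2 hF]]|G hG]; first exact: QACCq_reduction hF.
(* With equal moduli the compiled family stays in QACC[q] and thus in QACC. *)
have [F [hF red]] := QACCq_reduction q2 q2 hG.
by exists F; split=> //; exists q.
Qed.
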